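(* Let $p\ge1$, let $\mathcal I$ be a finite set with cardinality $D$, and let $(\xi_\lambda)_{\lambda\in\mathcal I}$ be centered independent sub-Gaussian real random variables. Put $Z=\sum_{\lambda\in\mathcal I}|\xi_\lambda|^p$ and $b=(b_\lambda)_{\lambda\in\mathcal I}$ with $b_\lambda=\big\||\xi_\lambda|^p-\mathbb E|\xi_\lambda|^p\big\|_{\psi_{2/p}}$. There exist positive constants $d_{1,p}$ and $d_{2,p}$ depending only on $p$ such that, for any $x>0$, $$\mathbb P\Big(|Z-\mathbb E[Z]|\ge d_{1,p}\|b\|_{\ell_2}\sqrt x+d_{2,p}\|b\|_{\ell_{1/(1-p/2)_+}}x^{p/2}\Big)\le2e^{-x}.$$ Moreover, if the $\xi_\lambda$ are also identically distributed, then, for any $x>0$, $$\mathbb P\Big(|Z-\mathbb E[Z]|\ge c_{1,p}\sqrt{Dx}+c_{2,p}D^{(1-p/2)_+}x^{p/2}\Big)\le2e^{-x},$$ where $c_{1,p}$ and $c_{2,p}$ depend only on $p$ and $\|\xi_\lambda\|_{\psi_2}$.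
   Context: For $r>0$, the Orlicz norm of a real random variable $X$ is $\|X\|_{\psi_r}=\inf\{\eta>0:\ \mathbb E[\exp((|X|/\eta)^r)]\le2\}$. A variable is sub-Gaussian if $\|X\|_{\psi_2}<\infty$. $(u)_+=\max(u,0)$. $\|b\|_{\ell_q}$ is the usual (unweighted) $\ell_q$-norm of the finite vector $b$; $1/(1-p/2)_+$ is read as $+\infty$ when $p\ge2$ (sup norm).
   Formalization: The first inequality with ''≥'' is stated only when b is not identically zero, since for b = 0 (e.g. Rademacher variables) the threshold is 0 and the bound fails for x > ln 2; the same bound with ''>'' is stated in all cases. In the i.i.d. part the index set is nonempty. *)

(* Defs.v *)
From HB Require Import structures.
From mathcomp Require Import all_boot all_order all_algebra.
From mathcomp Require Import all_classical all_reals all_analysis.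

Set Implicit Arguments.
Unset Strict Implicit.
Unset Printing Implicit Defensive.

Import Order.TTheory GRing.Theory Num.Theory.
Import numFieldNormedType.Exports.

Local Open Scope classical_set_scope.
Local Open Scope ring_scope.

(* Taken in \bar R: the infimum of the empty set is +oo. *)
Definition orlicz_norm d (T : measurableType d) (R : realType)
    (P : probability T R) (r : R) (X : T -> R) : \bar R :=
  ereal_inf [set eta%:E | eta in
    [set eta : R | 0 < eta /\
      ('E_P[fun w => expR ((`|X w| / eta) `^ r)] <= 2%:E)%E]].

Definition sub_gaussian d (T : measurableType d) (R : realType)
    (P : probability T R) (X : T -> R) : Prop :=
  (orlicz_norm P 2 X < +oo)%E.

(* Mutual independence: the product rule over every subfamily. *)
Definition mutually_independent d (T : measurableType d) (R : realType)
    (P : probability T R) (I : finType) (X : I -> T -> R) : Prop :=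
  forall (J : {set I}) (A : I -> set R), (forall i, measurable (A i)) ->
    P (\bigcap_(i in [set` J]) (X i @^-1` A i)) =
      (\prod_(i in J) P (X i @^-1` A i))%E.

Definition identically_distributed d (T : measurableType d) (R : realType)
    (P : probability T R) (I : finType) (X : I -> {RV P >-> R}) : Prop :=
  forall (i j : I) (A : set R), measurable A ->
    distribution P (X i) A = distribution P (X j) A.

(* The exponent -oo is never used; its value is a dummy. *)
Definition lq_norm (R : realType) (I : finType) (q : \bar R) (b : I -> R) : R :=
  match q with
  | r%:E%E => (\sum_(i : I) `|b i| `^ r) `^ r^-1
  | +oo%E => \big[Num.max/0]_(i : I) `|b i|
  | -oo%E => 0
  end.

Definition pos_part (R : realType) (u : R) : R := Num.max u 0.

(* In \bar R the inverse of 0 is +oo, so this is +oo as soon as 2 <= p. *)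
Definition dual_exponent (R : realType) (p : R) : \bar R :=
  ((pos_part (1 - p / 2)%R)%:E^-1)%E.

Definition mean d (T : measurableType d) (R : realType)
    (P : probability T R) (X : T -> R) : R := fine ('E_P[X])%E.

Definition power_sum (T : Type) (R : realType) (I : finType) (p : R)
    (xi : I -> T -> R) (w : T) : R := \sum_(i : I) `|xi i w| `^ p.

(* For sub-Gaussian xi i the Orlicz norm below is finite, so [fine] loses
   nothing (and likewise for [mean] above, all moments being finite). *)
Definition centered_power_norm d (T : measurableType d) (R : realType)
    (P : probability T R) (I : finType) (p : R) (xi : I -> T -> R) (i : I) : R :=
  let Y := fun w => `|xi i w| `^ p in
  fine (orlicz_norm P (2 / p) (fun w => Y w - mean P Y)).

(* Main.v *)
Require Import Defs.
From HB Require Import structures.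
From mathcomp Require Import all_boot all_order all_algebra.
From mathcomp Require Import all_classical all_reals all_analysis.
From mathcomp Require Import measurable_realfun ring lra.

Set Implicit Arguments.
Unset Strict Implicit.
Unset Printing Implicit Defensive.

Import Order.TTheory GRing.Theory Num.Theory.
Import numFieldNormedType.Exports.

Local Open Scope classical_set_scope.
Local Open Scope ring_scope.

(* The method is a moment estimate which, unlike the Laplace transform, is
   available for every p >= 1.  Let S be a sum of centered independent Y_i, with
   psi_{2/p} norms b_i.  For every l > 0, comparing the multinomial expansion of
   E S^n with a product of truncated exponential series gives
     |E S^n| <= n! l^-n prod_i sum_(k <= n) l^k |E Y_i^k| / k!.
   Since |E Y_i^k| <= 2 (k h)^(k h) b_i^k with h = p / 2, the k-th term is of
   order (C l b_i k^(h - 1))^k.  The terms k = 0, 1 contribute exactly 1, so the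
   i-th factor is at most exp(A (l b_i)^2) when h >= 1 and l b_i n^(h - 1) is
   small, and at most exp(A ((l b_i)^2 + (l b_i)^(1 / (1 - h)))) when h < 1.
   With q = 1 / (1 - h)_+ and 1 / l = |b|_2 / sqrt n + |b|_q n^(h - 1) / c the
   product is at most exp(2 A n), and Markov's inequality with an even n
   comparable to x gives the tail. *)

(** * Product rule for expectations of independent variables *)

Section integral_against_factor.
Import HBNNSimple.

(** Standard extension: the identity is linear, so it passes from indicators to simple functions,
    and monotone convergence along [nnsfun_approx] carries it to [g]. In the application [G] is the
    product of all factors but one and [c] is its expectation. *)
Lemma integral_mul_comp_of_indic d (T : measurableType d) (R : realType)
    (P : probability T R) (G : T -> R) (X : {RV P >-> R}) (c : R) :
  measurable_fun setT G -> (forall w, 0 <= G w) -> 0 <= c ->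
  (forall A : set R, measurable A ->
    \int[P]_w (G w * \1_A (X w))%:E = c%:E * \int[P]_w (\1_A (X w))%:E)%E ->
  forall g : R -> R, measurable_fun setT g -> (forall x, 0 <= g x) ->
    (\int[P]_w (G w * g (X w))%:E = c%:E * \int[P]_w (g (X w))%:E)%E.
Proof.
move=> mG G0 c0 GX g mg g0.
have /measurable_EFinP meg := mg.
pose h := nnsfun_approx measurableT meg.
have h0 n x : 0 <= h n x by [].
have mhX n : measurable_fun setT (fun w => h n (X w)).
  exact: measurableT_comp.
have nd_h x m n : (m <= n)%N -> h m x <= h n x.
  by move=> mn; exact/lefP/nd_nnsfun_approx.
have cvg_h x : (h n x)%:E @[n --> \oo] --> (g x)%:E.
  by apply: (cvg_nnsfun_approx measurableT meg) => // y _; rewrite /= lee_fin.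
have simpleE n : (\int[P]_w (G w * h n (X w))%:E =
    c%:E * \int[P]_w (h n (X w))%:E)%E.
  pose F (H : T -> R) y w := (y * (H w * \1_(h n @^-1` [set y]) (X w)))%:E.
  have F0 (H : T -> R) y w : (forall w, 0 <= H w) -> (0 <= F H y w)%E.
    move=> H0; rewrite /F lee_fin mulrCA mulr_ge0//.
    rewrite indicE; case: (X w \in _) / boolP; rewrite ?mulr0// inE /= => <-.
    by rewrite mulr1.
  have mF (H : T -> R) y : measurable_fun setT H -> measurable_fun setT (F H y).
    move=> mH; apply/measurable_EFinP; apply: measurable_funM => //.
    apply: measurable_funM => //; apply: (measurableT_comp _ (measurable_funP X)).
    exact: measurable_indic.
  have intF (H : T -> R) : measurable_fun setT H -> (forall w, 0 <= H w) ->
      (\int[P]_w (H w * h n (X w))%:E = \sum_(y \in range (h n))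
        y%:E * \int[P]_w (H w * \1_(h n @^-1` [set y]) (X w))%:E)%E.
    move=> mH H0; transitivity (\int[P]_w \sum_(y \in range (h n)) F H y w)%E.
      apply: eq_integral => w _; rewrite (fimfunE (h n)) mulrC.
      rewrite !fsbig_finite//= mulr_suml -sumEFin.
      by apply: eq_bigr => y _; rewrite /F -mulrA (mulrC (\1_ _ _)).
    rewrite ge0_integral_fsum//; last 2 first.
      by move=> y; exact: mF.
      by move=> y w _; exact: F0.
    apply: eq_fsbigr => y; rewrite inE => -[x _ <-].
    rewrite -ge0_integralZl_EFin//.
      by move=> w _; rewrite lee_fin mulr_ge0.
    apply/measurable_EFinP/measurable_funM => //.
    apply: (measurableT_comp _ (measurable_funP X)); exact: measurable_indic.
  rewrite intF//.
  have -> : (\int[P]_w (h n (X w))%:E = \int[P]_w (1 * h n (X w))%:E)%E.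
    by apply: eq_integral => w _; rewrite mul1r.
  rewrite (intF (fun=> 1))// ge0_mule_fsumr//; last first.
    (* Moving [c] into the sum needs a nonnegative term for every real [y]. For [y < 0] the level
       set of the nonnegative [h n] is empty, so the integral is 0. *)
    move=> y; have [y0|y0] := leP 0 y.
      by rewrite mule_ge0// integral_ge0// => w _; rewrite lee_fin mul1r.
    rewrite integral0_eq ?mule0// => w _; rewrite mul1r indicE memNset//= => hy.
    by have := h0 n (X w); rewrite hy leNgt y0.
  apply: eq_fsbigr => y _; rewrite muleCA GX//.
  by do 2 congr (_ * _)%E; apply: eq_integral => w _; rewrite mul1r.
(* Stated for a general weight because it serves twice: with [G] on the left side and with the
   constant 1 on the right side. *)
have cvgL (H : T -> R) : measurable_fun setT H -> (forall w, 0 <= H w) ->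
    (\int[P]_w (H w * h n (X w))%:E)%E @[n --> \oo] -->
    (\int[P]_w (H w * g (X w))%:E)%E.
  move=> mH H0.
  have := @cvg_monotone_convergence _ _ _ P setT measurableT
    (fun n w => (H w * h n (X w))%:E).
  have -> : (\int[P]_(x in setT) limn (fun n => (H x * h n (X x))%:E) =
      \int[P]_w (H w * g (X w))%:E)%E.
    apply: eq_integral => w _; apply/cvg_lim => //.
    under eq_fun do rewrite EFinM.
    by rewrite EFinM; apply: cvgeZl => //; exact: cvg_h.
  apply.
  - by move=> n; apply/measurable_EFinP/measurable_funM.
  - by move=> n w _; rewrite lee_fin mulr_ge0.
  - by move=> w _ m n mn; rewrite lee_fin ler_wpM2l// nd_h.
have cvgR : (\int[P]_w (G w * h n (X w))%:E)%E @[n --> \oo] -->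
    (c%:E * \int[P]_w (g (X w))%:E)%E.
  under eq_fun do rewrite simpleE.
  apply: cvgeZl => //.
  have := cvgL (fun=> 1) (@measurable_cst _ _ _ _ _ _) (fun=> ler01).
  under eq_fun do under eq_integral do rewrite mul1r.
  by under eq_integral do rewrite mul1r.
by apply: (cvg_unique _ (cvgL _ mG G0) cvgR); exact: ereal_hausdorff.
Qed.

End integral_against_factor.

(** Independence is the case where all factors are indicators. The induction runs over a list [s] of
    the indices whose factor may be arbitrary; each step frees one more factor by
    [integral_mul_comp_of_indic]. *)
Lemma independent_expectation_prod_ge0 d (T : measurableType d) (R : realType)
    (P : probability T R) (I : finType) (X : I -> {RV P >-> R}) :
  mutually_independent P (fun i => X i : T -> R) ->
  forall f : I -> R -> R, (forall i, measurable_fun setT (f i)) ->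
    (forall i x, 0 <= f i x) ->
    (forall i, (\int[P]_w (f i (X i w))%:E < +oo)%E) ->
    (\int[P]_w (\prod_i f i (X i w))%:E =
       \prod_i \int[P]_w (f i (X i w))%:E)%E.
Proof.
move=> indX f mf f0 finf.
suff H (s : seq I) : forall f : I -> R -> R,
    (forall i, measurable_fun setT (f i)) -> (forall i x, 0 <= f i x) ->
    (forall i, (\int[P]_w (f i (X i w))%:E < +oo)%E) ->
    (forall i, i \notin s -> exists2 A : set R, measurable A & f i = \1_A) ->
    (\int[P]_w (\prod_i f i (X i w))%:E =
       \prod_i \int[P]_w (f i (X i w))%:E)%E.
  by apply: (H (enum I)) => // i; rewrite mem_enum.
elim: s => [|i s IH] {mf f0 finf}f mf f0 finf findic.
  have /choice[A AP] : forall i, exists A : set R, measurable A /\ f i = \1_A.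
    by move=> i; have [//|A mA ->] := findic i; exists A.
  have mA i : measurable (A i) by have [] := AP i.
  have mXA i : measurable (X i @^-1` A i).
    by rewrite -[_ @^-1` _]setTI; exact: measurable_funP.
  have fE i w : f i (X i w) = \1_(X i @^-1` A i) w.
    by have [_ ->] := AP i; rewrite !indicE; congr (_%:R).
  transitivity (\int[P]_w (\1_(\bigcap_(i in [set` [set: I]%SET])
      (X i @^-1` A i)) w)%:E)%E.
    apply: eq_integral => w _; congr EFin; rewrite indicE.
    case: (w \in _) / boolP => wA /=.
      rewrite big1// => j _; rewrite fE indicE mem_set//.
      by move: wA; rewrite inE => /(_ j); apply; rewrite /= inE.
    have [j wj] : exists j, ~ (X j @^-1` A j) w.
      apply: contrapT => /forallNP wj; move/negP: wA; apply; rewrite inE.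
      by move=> j _; exact: contrapT (wj j).
    by rewrite (bigD1 j)//= fE indicE memNset// mul0r.
  rewrite integral_indic// ?setIT; last first.
    by apply: fin_bigcap_measurable.
  apply: (etrans (indX [set: I]%SET A mA)).
  apply: eq_big => [j|j _]; first by rewrite inE.
  by under eq_integral do rewrite fE; rewrite integral_indic// setIT.
have [iS|iS] := boolP (i \in s).
  apply: IH => // j js; apply: findic; rewrite inE (negPf js) orbF.
  by apply: contraNneq js => ->.
have int_fin (g : I -> R -> R) j : (forall x, 0 <= g j x) ->
    (\int[P]_w (g j (X j w))%:E < +oo)%E ->
    (\int[P]_w (g j (X j w))%:E \is a fin_num)%E.
  move=> g0 gy; rewrite ge0_fin_numE// integral_ge0// => w _.
  by rewrite lee_fin.
rewrite (bigD1 i)//=.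
set c := (X in _ = (_ * X)%E).
have cfin : c \is a fin_num.
  rewrite /c; apply: (big_ind (fun x : \bar R => x \is a fin_num)) => //.
    by move=> x y; exact: fin_numM.
  by move=> j ji; exact: int_fin.
have c0 : (0 <= c)%E.
  by apply: prode_ge0 => j _; apply: integral_ge0 => w _; rewrite lee_fin.
pose G w := \prod_(j | j != i) f j (X j w).
have mG : measurable_fun setT G.
  rewrite /G; under eq_fun do rewrite -big_filter.
  by apply: measurable_prod => j _; exact: measurableT_comp.
transitivity (\int[P]_w (G w * f i (X i w))%:E)%E.
  by apply: eq_integral => w _; rewrite (bigD1 i)//= mulrC.
rewrite muleC -(fineK cfin); apply: integral_mul_comp_of_indic => //.
- by move=> w; apply: prodr_ge0 => j _.
- exact: fine_ge0.
(* With the factor at [i] replaced by an indicator, every factor outside [s] is an indicator, so the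
   induction hypothesis applies to [g]. *)
move=> A mA; pose g j := if j == i then \1_A else f j.
have g0 j x : 0 <= g j x by rewrite /g; case: ifP.
have gi : g i = \1_A by rewrite /g eqxx.
have gj j : j != i -> g j = f j by move=> /negPf ji; rewrite /g ji.
have mg j : measurable_fun setT (g j).
  by rewrite /g; case: ifP => // _; exact: measurable_indic.
have gfin j : (\int[P]_w (g j (X j w))%:E < +oo)%E.
  have [->|ji] := eqVneq j i; last by rewrite gj.
  apply: (@le_lt_trans _ _ (\int[P]_w 1)%E); last first.
    by rewrite integral_cst// mul1e (le_lt_trans (probability_le1 _ _)) ?ltry.
  apply: ge0_le_integral => //.
  + by move=> w _; rewrite lee_fin.
  + exact/measurable_EFinP/(measurableT_comp (mg i) (measurable_funP (X i))).
  + by move=> w _; rewrite gi lee_fin indicE; case: (_ \in _).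
have gindic j : j \notin s -> exists2 A : set R, measurable A & g j = \1_A.
  move=> js; have [->|ji] := eqVneq j i; first by exists A.
  by rewrite gj//; apply: findic; rewrite inE negb_or ji.
transitivity (\int[P]_w (\prod_j g j (X j w))%:E)%E.
  apply: eq_integral => w _; rewrite [in RHS](bigD1 i)//= gi mulrC.
  by congr ((_ * _)%:E); apply: eq_bigr => j ji; rewrite gj.
rewrite IH// (bigD1 i)//= gi muleC fineK//; congr (_ * _)%E.
by apply: eq_bigr => j ji; rewrite gj.
Qed.

Lemma Rintegral_sum d (T : measurableType d) (R : realType)
    (mu : {measure set T -> \bar R}) (J : Type) (s : seq J) (h : J -> T -> R) :
  (forall j, mu.-integrable setT (EFin \o h j)) ->
  \int[mu]_w (\sum_(j <- s) h j w) = \sum_(j <- s) \int[mu]_w h j w.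
Proof.
move=> ih; apply: EFin_inj; rewrite -sumEFin.
rewrite (eq_bigr (fun j => \int[mu]_w (h j w)%:E)%E); last first.
  by move=> j _; rewrite /Rintegral fineK// integrable_fin_num//; exact: ih.
rewrite -(integral_sum measurableT ih) /Rintegral.
under eq_integral do rewrite -sumEFin.
rewrite fineK// integrable_fin_num//; apply: integrable_sum => // j _; exact: ih.
Qed.

Lemma integrable_sumr d (T : measurableType d) (R : realType)
    (mu : {measure set T -> \bar R}) (J : Type) (s : seq J) (h : J -> T -> R) :
  (forall j, mu.-integrable setT (EFin \o h j)) ->
  mu.-integrable setT (fun w => (\sum_(j <- s) h j w)%:E).
Proof.
move=> ih; apply: eq_integrable (@integrable_sum _ _ _ mu setT measurableT _ s
  predT _ (fun j _ => ih j)) => // w _; by rewrite -sumEFin.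
Qed.

Lemma integrableZlr d (T : measurableType d) (R : realType)
    (mu : {measure set T -> \bar R}) (c : R) (h : T -> R) :
  mu.-integrable setT (EFin \o h) -> mu.-integrable setT (fun w => (c * h w)%:E).
Proof. by move=> ih; have := @integrableZl _ _ _ mu _ measurableT c _ ih. Qed.

Section independent_products.
Context d (T : measurableType d) (R : realType) (P : probability T R).
Context (I : finType) (X : I -> {RV P >-> R}).
Hypothesis indX : mutually_independent P (fun i => X i : T -> R).

(** The absolute value of the product is the product of the absolute values, to which the
    nonnegative product rule applies. *)
Lemma independent_integrable_prod (f : I -> R -> R) :
  (forall i, measurable_fun setT (f i)) ->
  (forall i, P.-integrable setT (fun w => (f i (X i w))%:E)) ->
  P.-integrable setT (fun w => (\prod_i f i (X i w))%:E).
Proof.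
move=> mf iF; apply/integrableP; split.
  apply/measurable_EFinP; apply: measurable_prod => i _.
  exact: (measurableT_comp (mf i) (measurable_funP (X i))).
under eq_integral do rewrite abse_EFin normr_prod.
rewrite (independent_expectation_prod_ge0 indX (f := fun i x => `|f i x|))//.
- have fin i : (\int[P]_w `|f i (X i w)|%:E)%E \is a fin_num.
    by have /integrable_abse /integrable_fin_num := iF i; exact.
  rewrite ltey_eq; apply/orP; left.
  by apply: (big_ind (fun x : \bar R => x \is a fin_num)) => // x y; exact: fin_numM.
- by move=> i; exact: measurableT_comp.
- by move=> i; have /integrableP[] := iF i.
Qed.

Lemma independent_Rintegral_prod_ge0 (f : I -> R -> R) :
  (forall i, measurable_fun setT (f i)) -> (forall i x, 0 <= f i x) ->
  (forall i, P.-integrable setT (fun w => (f i (X i w))%:E)) ->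
  \int[P]_w (\prod_i f i (X i w)) = \prod_i \int[P]_w (f i (X i w)).
Proof.
move=> mf f0 iF; apply: EFin_inj; rewrite /Rintegral fineK; last first.
  by rewrite integrable_fin_num// independent_integrable_prod.
rewrite (independent_expectation_prod_ge0 indX)//; last first.
  by move=> i; exact: integrable_lty.
by rewrite -prodEFin; apply: eq_bigr => i _; rewrite fineK// integrable_fin_num.
Qed.

Lemma independent_Rintegral_prod (f : I -> R -> R) :
  (forall i, measurable_fun setT (f i)) ->
  (forall i, P.-integrable setT (fun w => (f i (X i w))%:E)) ->
  \int[P]_w (\prod_i f i (X i w)) = \prod_i \int[P]_w (f i (X i w)).
Proof.
move=> mf iF.
pose fs i (b : bool) x := 2^-1 * (`|f i x| + (-1) ^+ b * f i x).
(* [fs i false] and [fs i true] are the positive and negative parts of [f i]. *)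
have fE i x : f i x = \sum_(b : bool) (-1) ^+ b * fs i b x.
  by rewrite big_bool /fs /= expr0 expr1; lra.
have fs0 i b x : 0 <= fs i b x.
  rewrite mulr_ge0// -lerBlDr sub0r; case: b; rewrite ?expr0 ?expr1 ?mulN1r ?mul1r.
    by rewrite opprK ler_norm.
  by rewrite -normrN ler_norm.
have mfs i b : measurable_fun setT (fs i b).
  apply: measurable_funM => //; apply: measurable_funD.
    exact: measurableT_comp.
  exact: measurable_funM.
have ifs i b : P.-integrable setT (fun w => (fs i b (X i w))%:E).
  apply: (le_integrable measurableT _ _ (iF i)).
    exact/measurable_EFinP/(measurableT_comp (mfs i b) (measurable_funP (X i))).
  move=> w _; rewrite /= lee_fin ger0_norm//.
  rewrite /fs ler_pdivrMl//; have := ler_norm (f i (X i w)).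
  have := ler_norm (- f i (X i w)); rewrite normrN.
  by case: b; rewrite ?expr0 ?expr1; lra.
under eq_Rintegral do under eq_bigr do rewrite fE.
under eq_Rintegral do rewrite bigA_distr_bigA.
under eq_Rintegral do under eq_bigr do rewrite big_split.
rewrite Rintegral_sum; last first.
  move=> phi; apply: integrableZlr.
  exact: (independent_integrable_prod (f := fun i => fs i (phi i))).
transitivity (\sum_(phi : {ffun I -> bool})
    \prod_i ((-1) ^+ phi i * \int[P]_w fs i (phi i) (X i w))).
  apply: eq_bigr => phi _; rewrite RintegralZl//; last first.
    exact: (independent_integrable_prod (f := fun i => fs i (phi i))).
  rewrite (independent_Rintegral_prod_ge0 (f := fun i => fs i (phi i)))//.
  by rewrite big_split.
rewrite -(bigA_distr_bigA (fun i (b : bool) =>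
  (-1) ^+ b * \int[P]_w fs i b (X i w))).
apply: eq_bigr => i _; under [RHS]eq_Rintegral do rewrite fE.
rewrite Rintegral_sum; last first.
  by move=> b; exact: (integrableZlr ((-1) ^+ b) (ifs i b)).
apply: eq_bigr => b _.
exact/esym/(RintegralZl ((-1) ^+ b) measurableT (ifs i b)).
Qed.

End independent_products.

(** * Moments of a sum of independent variables *)

(* When the Y_i are independent and M i j = E Y_i^j, [sum_moment M s k] is the
   k-th moment of the sum of the Y_i over s. *)
Fixpoint sum_moment (R : realType) (I : Type) (M : I -> nat -> R) (s : seq I)
    (k : nat) : R :=
  if s is i :: s' then
    \sum_(j < k.+1) 'C(k, j)%:R * (sum_moment M s' (k - j) * M i j)
  else (k == 0%N)%:R.

(** The left side collects the pairs of indices with sum below [n]; they form a part of the square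
    of pairs on the right, and all terms are nonnegative. *)
Lemma sum_convolution_le (R : realType) (u v : nat -> R) n :
  (forall k, 0 <= u k) -> (forall k, 0 <= v k) ->
  \sum_(k < n) \sum_(j < k.+1) u (k - j)%N * v j <=
    (\sum_(k < n) u k) * \sum_(j < n) v j.
Proof.
move=> u0 v0.
rewrite (eq_bigr (fun k : 'I_n => \sum_(j < n | (j <= k)%N) u (k - j)%N * v j));
  last first.
  by move=> k _; rewrite (big_ord_widen_cond n predT (fun j => u (k - j)%N * v j))//.
rewrite (exchange_big_dep predT)//= mulr_sumr; apply: ler_sum => j _.
rewrite -mulr_suml ler_wpM2r//.
rewrite -(big_mkord (fun k => (j <= k)%N) (fun k => u (k - j)%N)).
rewrite (big_cat_nat _ (n := j))//=; last exact: ltnW.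
rewrite big_nat_cond big1 ?add0r; last first.
  by move=> k /andP[/andP[_ kj]]; rewrite leqNgt kj.
rewrite -{1}[j : nat]add0n big_addn.
rewrite (eq_big predT u); last 2 first.
- by move=> k; rewrite leq_addl.
- by move=> k _; rewrite addnK.
rewrite -(big_mkord predT u) (big_cat_nat _ (n := (n - j)%N) (p := n))//= ?leq_subr//.
by rewrite lerDl sumr_ge0.
Qed.

(** Division by [k!] turns the binomial recursion of [sum_moment] into a convolution, so by
    [sum_convolution_le] each further variable costs at most one further factor. *)
Lemma sum_moment_le (R : realType) (I : Type) (M : I -> nat -> R) (l : R)
    (s : seq I) (n : nat) : 0 <= l ->
  \sum_(k < n.+1) l ^+ k * `|sum_moment M s k| / k`!%:R <=
    \prod_(i <- s) \sum_(k < n.+1) l ^+ k * `|M i k| / k`!%:R.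
Proof.
move=> l0; elim: s => [|i s IH].
  rewrite big_nil big_ord_recl /= big1 ?addr0 ?normr1 ?mulr1 ?expr0 ?divr1//.
  by move=> k _; rewrite normr0 mulr0 mul0r.
have pos (x : R) k : 0 <= l ^+ k * `|x| / k`!%:R.
  by rewrite divr_ge0// mulr_ge0// exprn_ge0.
rewrite big_cons mulrC.
apply: le_trans; last first.
  by apply: ler_wpM2r IH; apply: sumr_ge0 => k _; exact: pos.
apply: le_trans; last exact: (sum_convolution_le
  (u := fun k => l ^+ k * `|sum_moment M s k| / k`!%:R)
  (v := fun k => l ^+ k * `|M i k| / k`!%:R)).
apply: ler_sum => k _ /=.
have kf0 : 0 < k`!%:R :> R by rewrite ltr0n fact_gt0.
rewrite ler_pdivrMr//.
apply: le_trans (ler_wpM2l (exprn_ge0 k l0) (ler_norm_sum _ _ _)) _.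
rewrite mulr_sumr mulr_suml; apply: ler_sum => j _.
have jk : (j <= k)%N by rewrite -ltnS.
rewrite normrM (ger0_norm (ler0n _ _)) normrM.
have -> : l ^+ k = l ^+ (k - j) * l ^+ j by rewrite -exprD subnK.
have -> : k`!%:R = ('C(k, j))%:R * (j`!%:R * (k - j)`!%:R) :> R.
  by rewrite -!natrM bin_fact.
have jf0 : (j`!%:R : R) != 0 by rewrite pnatr_eq0 -lt0n fact_gt0.
have kjf0 : ((k - j)`!%:R : R) != 0 by rewrite pnatr_eq0 -lt0n fact_gt0.
by rewrite le_eqVlt; apply/orP; left; apply/eqP; field; rewrite jf0.
Qed.

Lemma Rintegral_one d (T : measurableType d) (R : realType)
    (P : probability T R) : \int[P]_w 1 = 1 :> R.
Proof.
rewrite Rintegral_cst// mul1r [X in fine X](_ : _ = 1%E)//.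
exact: probability_setT.
Qed.

Section moments_of_independent_sums.
Context d (T : measurableType d) (R : realType) (P : probability T R).
Context (I : finType) (X : I -> {RV P >-> R}) (g : I -> R -> R).
Hypothesis indX : mutually_independent P (fun i => X i : T -> R).
Hypothesis mg : forall i, measurable_fun setT (g i).
Hypothesis ig : forall i k, P.-integrable setT (fun w => (g i (X i w) ^+ k)%:E).
Let M i k := \int[P]_w (g i (X i w) ^+ k).

(* Carrying the extra monomial (with exponents [e] vanishing on s) lets the
   induction peel off one variable at a time by the product rule alone, without
   proving that partial sums are independent of the remaining variables. *)
Lemma independent_sum_moment (s : seq I) (k : nat) (e : I -> nat) :
  uniq s -> (forall i, i \in s -> e i = 0%N) ->
  let F w := (\sum_(i <- s) g i (X i w)) ^+ k * \prod_i g i (X i w) ^+ e i in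
  P.-integrable setT (EFin \o F) /\
  \int[P]_w F w = sum_moment M s k * \prod_i M i (e i).
Proof.
elim: s k e => [|i s IH] k e /=.
  have mge i : measurable_fun setT (fun x => g i x ^+ e i).
    exact: measurable_funX.
  have ip : P.-integrable setT (fun w => (\prod_i g i (X i w) ^+ e i)%:E).
    exact: (independent_integrable_prod indX (f := fun i x => g i x ^+ e i)).
  have cE w : (\sum_(i <- [::]) g i (X i w)) ^+ k = (k == 0%N)%:R.
    by rewrite big_nil expr0n.
  split.
    by under eq_fun do rewrite /= cE; exact: (integrableZlr _ ip).
  under eq_Rintegral do rewrite cE.
  rewrite (RintegralZl _ measurableT ip); congr (_ * _).
  exact: (independent_Rintegral_prod indX (f := fun i x => g i x ^+ e i)).
move=> /andP[iS us] es.
have ei : e i = 0%N by apply: es; rewrite inE eqxx.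
(* The binomial theorem separates [g i] from the rest of the sum; its power [j] is stored in the
   monomial, where the exponent of [i] was 0. *)
pose ej j l := if l == i then j else e l.
have ejs j l : l \in s -> ej j l = 0%N.
  move=> ls; rewrite /ej; case: eqP => [li|_]; first by rewrite -li ls in iS.
  by apply: es; rewrite inE ls orbT.
pose F j w := (\sum_(l <- s) g l (X l w)) ^+ (k - j) *
              \prod_l g l (X l w) ^+ ej j l.
have ejE (H : I -> nat -> R) (j : nat) : H i 0%N = 1 ->
    \prod_l H l (ej j l) = H i j * \prod_l H l (e l).
  move=> Hi; rewrite (bigD1 i)//= [in RHS](bigD1 i)//= ei Hi mul1r /ej eqxx.
  by congr (_ * _); apply: eq_bigr => l /negPf ->.
have FE w : (\sum_(l <- i :: s) g l (X l w)) ^+ k * \prod_l g l (X l w) ^+ e l =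
    \sum_(j < k.+1) 'C(k, j)%:R * F j w.
  rewrite big_cons addrC exprDn mulr_suml; apply: eq_bigr => j _.
  rewrite /F (ejE (fun l n => g l (X l w) ^+ n))// -mulr_natl; ring.
have iF j : P.-integrable setT (EFin \o F j).
  by have [] := IH (k - j)%N (ej j) us (ejs j).
split.
  under eq_fun do rewrite /= FE.
  by apply: integrable_sumr => j; exact: (integrableZlr _ (iF j)).
under eq_Rintegral do rewrite FE.
rewrite Rintegral_sum; last by move=> j; exact: (integrableZlr _ (iF j)).
rewrite mulr_suml; apply: eq_bigr => j _.
rewrite (RintegralZl _ measurableT (iF j)).
have [_ ->] := IH (k - j)%N (ej j) us (ejs j).
rewrite (ejE M)/M; last first.
  by under eq_Rintegral do rewrite expr0; exact: Rintegral_one.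
by rewrite !mulrA.
Qed.

(** The term [k = n] alone is at most the whole sum of nonnegative terms bounded in [sum_moment_le];
    solving for the moment gives the factor [n! l^-n]. *)
Lemma independent_sum_moment_le (n : nat) (l : R) : 0 < l ->
  P.-integrable setT (fun w => ((\sum_i g i (X i w)) ^+ n)%:E) /\
  `|\int[P]_w ((\sum_i g i (X i w)) ^+ n)| <=
    n`!%:R * l ^- n * \prod_i \sum_(k < n.+1) l ^+ k * `|M i k| / k`!%:R.
Proof.
move=> l0.
have nl0 : 0 <= n`!%:R * l ^- n.
  by rewrite mulr_ge0// invr_ge0 exprn_ge0// ltW.
have [] := @independent_sum_moment (index_enum I) n (fun=> 0%N)
  (index_enum_uniq I) (fun _ _ => erefl).
rewrite (_ : (fun w => _ * _) = fun w => (\sum_i g i (X i w)) ^+ n); last first.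
  by apply/funext => w; rewrite [X in _ * X]big1 ?mulr1.
move=> iS ->; split=> //.
rewrite big1 ?mulr1; last first.
  move=> i _; rewrite /M.
  by under eq_Rintegral do rewrite expr0; exact: Rintegral_one.
apply: le_trans (ler_wpM2l _ (sum_moment_le M (index_enum I) n (ltW l0))) => //.
rewrite big_ord_recr /= mulrDr -[leLHS]add0r lerD//.
  rewrite mulr_ge0//.
  by apply: sumr_ge0 => k _; rewrite divr_ge0// mulr_ge0// exprn_ge0// ltW.
have nf0 : (n`!%:R : R) != 0 by rewrite pnatr_eq0 -lt0n fact_gt0.
by rewrite le_eqVlt; apply/orP; left; apply/eqP; field; rewrite nf0 expf_neq0// gt_eqF.
Qed.

End moments_of_independent_sums.

(** * Truncated exponential series of moment bounds *)

Lemma powR_le_expR (R : realType) (a v : R) : 0 <= a -> 0 <= v ->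
  v `^ a <= a `^ a * expR v.
Proof.
rewrite le_eqVlt => /predU1P[<- v0|a0 v0].
  by rewrite !powRr0 mul1r (le_trans _ (expR_ge1Dx _))// lerDl.
have -> : v = a * (v / a) by rewrite mulrCA divff ?mulr1// gt_eqF.
rewrite [X in X <= _]powRM ?divr_ge0//; [|exact: ltW..].
apply: ler_wpM2l; first exact: powR_ge0.
rewrite [in leRHS]mulrC expRM ge0_ler_powR ?nnegrE ?expR_ge0 ?divr_ge0 ?(ltW a0)//.
by rewrite (le_trans _ (expR_ge1Dx _))// lerDr.
Qed.

(** The quotient [k^k / k!] is one term of the exponential series at [k]. *)
Lemma exprn_le_fact_expR (R : realType) (k : nat) :
  k%:R ^+ k <= k`!%:R * expR 1 ^+ k :> R.
Proof.
case: k => [|n]; first by rewrite !expr0 mulr1.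
have := expR_ge1Dxn n (ler0n R n.+1).
rewrite -expRM_natl mulr1 => h.
rewrite -ler_pdivrMl ?ltr0n ?fact_gt0// mulrC (le_trans _ h)//.
by rewrite lerDr.
Qed.

Lemma sum_le_geometric (R : realType) (f : nat -> R) (B : R) (n : nat) :
  f 0%N = 1 -> f 1%N = 0 -> 0 <= B ->
  (forall k, (2 <= k <= n)%N -> f k <= B * 2^-1 ^+ k) ->
  \sum_(k < n.+1) f k <= 1 + B.
Proof.
move=> f0 f1 B0 fk.
(* The sharper bound is inductive: each new term uses half of the remaining slack [B 2^-n]. *)
suff : \sum_(k < n.+1) f k <= 1 + B * (1 - 2^-1 ^+ n).
  move=> /le_trans; apply; rewrite lerD2l ler_piMr// gerBl exprn_ge0//.
elim: n fk => [|n IH] fk.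
  by rewrite big_ord_recl big_ord0 f0 expr0 subrr mulr0.
rewrite big_ord_recr /=.
have {}IH : \sum_(k < n.+1) f k <= 1 + B * (1 - 2^-1 ^+ n).
  by apply: IH => k /andP[k2 kn]; apply: fk; rewrite k2 leqW.
have fn : f n.+1 <= B * 2^-1 ^+ n.+1.
  case: n fk {IH} => [|n] fk; first by rewrite f1 mulr_ge0// exprn_ge0.
  by apply: fk; rewrite leqnn.
apply: le_trans (lerD IH fn) _; rewrite exprS; set e := 2^-1 ^+ n.
have := B0; nra.
Qed.

(* A bound of the k-th absolute moment of a variable of unit psi_{1/h} norm:
   v^a <= a^a e^v with v = |y|^(1/h) and a = k h. *)
Definition moment_cst (R : realType) (h : R) (k : nat) : R :=
  2 * (k%:R * h) `^ (k%:R * h).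

(** Since [(k h)^(k h) = (k k^(h - 1) h^h)^k], the factor [k^k] is cancelled by [k!] at the price of
    [e^k]. *)
Lemma moment_cst_div_fact_le (R : realType) (h a : R) (k : nat) :
  0 < h -> 0 <= a -> (0 < k)%N ->
  moment_cst h k * a ^+ k / k`!%:R <=
    2 * (expR 1 * h `^ h * a * k%:R `^ (h - 1)) ^+ k.
Proof.
move=> h0 a0 k0; have kR : 0 < k%:R :> R by rewrite ltr0n.
have -> : moment_cst h k = 2 * (k%:R * k%:R `^ (h - 1) * h `^ h) ^+ k.
  rewrite /moment_cst [in X in _ `^ X]mulrC powRrM powR_mulrn ?powR_ge0//.
  by rewrite powRM ?(ltW h0)// mulr_powRB1.
set u := k%:R `^ (h - 1); set w := h `^ h.
have z0 : 0 <= (w * a * u) ^+ k by rewrite exprn_ge0// !mulr_ge0// powR_ge0.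
rewrite ler_pdivrMr ?ltr0n ?fact_gt0//.
have -> : 2 * (k%:R * u * w) ^+ k * a ^+ k = 2 * (k%:R ^+ k * (w * a * u) ^+ k).
  by rewrite -mulrA -!exprMn; congr (_ * _ ^+ _); ring.
have -> : 2 * (expR 1 * w * a * u) ^+ k * k`!%:R =
    2 * (k`!%:R * expR 1 ^+ k * (w * a * u) ^+ k).
  rewrite -[_ * w * a * u]mulrA -[_ * w * _]mulrA [w * _]mulrA exprMn; ring.
by rewrite ler_pM2l// ler_wpM2r// exprn_le_fact_expR.
Qed.

Lemma powR_nat_le1 (R : realType) (k : nat) (s : R) :
  (0 < k)%N -> s <= 0 -> k%:R `^ s <= 1 :> R.
Proof.
move=> k0 s0; apply: le_trans (ler_powR _ s0) _; first by rewrite ler1n.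
by rewrite powRr0.
Qed.

Lemma moment_series_le_heavy (R : realType) (h : R) : 1 <= h ->
  exists A c : R, [/\ 0 < A, 0 < c &
    forall (n : nat) (a : R) (f : nat -> R), 0 <= a -> a * n%:R `^ (h - 1) <= c ->
    f 0%N = 1 -> f 1%N = 0 ->
    (forall k, (2 <= k <= n)%N -> f k <= moment_cst h k * a ^+ k / k`!%:R) ->
    \sum_(k < n.+1) f k <= expR (A * a ^+ 2)].
Proof.
move=> h1; have h0 : 0 < h by exact: lt_le_trans h1.
set C := expR 1 * h `^ h; set e : R := expR 1.
have e0 : 0 < e by exact: expR_gt0.
have C0 : 0 < C by rewrite mulr_gt0 ?expR_gt0// powR_gt0.
set s := h - 1; have s0 : 0 <= s by rewrite subr_ge0.
set D := (2 * s) `^ (2 * s).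
have D0 : 0 <= D by exact: powR_ge0.
have E0 : 0 <= (2 * e) ^+ 2 * C ^+ 2 * D.
  exact: mulr_ge0 (mulr_ge0 (sqr_ge0 _) (sqr_ge0 _)) D0.
(* The second witness makes the base [y] of the k-th term at most [1 / (2 e)]. In the first, [D]
   comes from [k^(2 s) <= (2 s)^(2 s) e^k], and the [+ 1] gives positivity from [0 <= D]. *)
exists (2 * ((2 * e) ^+ 2 * C ^+ 2 * D) + 1), (2 * e * C)^-1; split.
- by rewrite ltr_wpDl// mulr_ge0.
- by rewrite invr_gt0; apply: mulr_gt0 => //; exact: mulr_gt0.
move=> n a f a0 an f0 f1 fk.
set B := 2 * ((2 * e) ^+ 2 * C ^+ 2 * D) * a ^+ 2.
have B0 : 0 <= B by rewrite /B mulr_ge0 ?sqr_ge0// mulr_ge0.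
apply: le_trans (sum_le_geometric f0 f1 B0 _) _; last first.
  apply: le_trans (expR_ge1Dx _) _; rewrite ler_expR mulrDl lerDl mul1r.
  by rewrite exprn_ge0.
move=> k /andP[k2 kn]; have k0 : (0 < k)%N by exact: leq_trans k2.
apply: le_trans (fk k _) _; first by rewrite k2.
apply: le_trans (moment_cst_div_fact_le h0 a0 k0) _.
have an' : a * k%:R `^ s <= (2 * e * C)^-1.
  apply: le_trans an; rewrite ler_wpM2l// ge0_ler_powR ?nnegrE//.
  by rewrite ler_nat.
have kD : (k%:R `^ s) ^+ 2 <= D * e ^+ k.
  rewrite -powR_mulrn ?powR_ge0// -powRrM mulrC.
  apply: le_trans (powR_le_expR _ _) _ => //; first by rewrite mulr_ge0.
  by rewrite -/D /e -expRM_natl mulr1.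
(* For k <= n, y <= 1 / (2 e), so y^k = y^2 y^(k - 2) decays like (2 e)^-k, and
   the factor k^(2 s) lost in y^2 is absorbed by e^k. *)
set y := C * (a * k%:R `^ s).
have y0 : 0 <= y by rewrite /y !mulr_ge0 ?powR_ge0// ltW.
have ye : y <= (2 * e)^-1.
  by rewrite /y -ler_pdivlMl// -invfM [C * _]mulrC.
have -> : expR 1 * h `^ h * a * k%:R `^ (h - 1) = y by rewrite /y mulrA.
rewrite /B -mulrA -mulrA ler_pM2l//.
have -> : y ^+ k = y ^+ 2 * y ^+ (k - 2) by rewrite -exprD subnKC.
apply: (@le_trans _ _ (y ^+ 2 * (2 * e)^-1 ^+ (k - 2))).
  by rewrite ler_wpM2l ?exprn_ge0// lerXn2r// nnegrE invr_ge0 mulr_ge0// ltW.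
have -> : (2 * e)^-1 ^+ (k - 2) = (2 * e) ^+ 2 * (2^-1 ^+ k * e ^- k).
  rewrite -exprVn -exprMn -invfM -[in RHS](subnKC k2) exprD mulrA -exprMn.
  by rewrite divff ?expr1n ?mul1r// mulf_neq0// gt_eqF.
have -> : y ^+ 2 * ((2 * e) ^+ 2 * (2^-1 ^+ k * e ^- k)) =
    ((2 * e) ^+ 2 * C ^+ 2 * a ^+ 2 * 2^-1 ^+ k) * ((k%:R `^ s) ^+ 2 / e ^+ k).
  by rewrite /y; ring.
have -> : (2 * e) ^+ 2 * C ^+ 2 * D * (a ^+ 2 * 2^-1 ^+ k) =
    ((2 * e) ^+ 2 * C ^+ 2 * a ^+ 2 * 2^-1 ^+ k) * D by ring.
rewrite ler_wpM2l//; last by rewrite ler_pdivrMr ?exprn_gt0.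
by rewrite mulr_ge0 ?exprn_ge0// mulr_ge0 ?sqr_ge0// mulr_ge0 ?sqr_ge0.
Qed.

(** For [h < 1] the factor [k^(h - 1)] in the base of the k-th term decreases in [k], so no
    smallness of [a] is required: a large [a] is paid for by the power [1 / (1 - h)] in the
    exponent. *)
Lemma moment_series_le_light (R : realType) (h : R) : 2^-1 <= h < 1 ->
  exists A : R, 0 < A /\
    forall (n : nat) (a : R) (f : nat -> R), 0 <= a ->
    f 0%N = 1 -> f 1%N = 0 ->
    (forall k, (2 <= k <= n)%N -> f k <= moment_cst h k * a ^+ k / k`!%:R) ->
    \sum_(k < n.+1) f k <= expR (A * (a ^+ 2 + a `^ (1 - h)^-1)).
Proof.
move=> /andP[h2 h1]; have h0 : 0 < h by apply: lt_le_trans h2; rewrite invr_gt0.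
set C := expR 1 * h `^ h.
have C0 : 0 < C by rewrite mulr_gt0 ?expR_gt0// powR_gt0.
set r := 1 - h; have r0 : 0 < r by rewrite subr_gt0.
set q := r^-1; have q0 : 0 < q by rewrite invr_gt0.
exists (8 * C ^+ 2 + (2 * C) `^ q); split.
  by rewrite ltr_wpDr ?powR_ge0// mulr_gt0// exprn_gt0.
move=> n a f a0 f0 f1 fk; set u := C * a.
have u0 : 0 <= u by rewrite mulr_ge0// ltW.
have C20 : 0 <= 2 * C by apply: mulr_ge0 => //; exact: ltW.
set v := (2 * u) `^ q; have v0 : 0 <= v by exact: powR_ge0.
apply: (@le_trans _ _ (expR (8 * u ^+ 2 + v))); last first.
  rewrite ler_expR /u /v [in leLHS]/u mulrA powRM//.
  rewrite exprMn -/q; set aq := a `^ q; set Cq := (2 * C) `^ q.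
  have h3 : 0 <= C ^+ 2 * aq by rewrite mulr_ge0 ?sqr_ge0 ?powR_ge0.
  have h4 : 0 <= Cq * a ^+ 2 by rewrite mulr_ge0 ?sqr_ge0 ?powR_ge0.
  by lra.
have fk' k : (2 <= k <= n)%N -> f k <= 2 * (u * k%:R `^ (- r)) ^+ k.
  move=> /[dup] k2n /andP[k2 _]; apply: le_trans (fk k k2n) _.
  apply: le_trans (moment_cst_div_fact_le h0 a0 _) _; first exact: leq_trans k2.
  by rewrite /u /r opprB.
(* For [u <= 1 / 2], [k^-r <= 1] and [u^k <= u^2 2^-(k - 2)] give a geometric bound with
   [B = 8 u^2]. *)
have [u2|u2] := leP u 2^-1.
  have B0 : 0 <= 8 * u ^+ 2 by rewrite mulr_ge0// exprn_ge0.
  apply: le_trans (sum_le_geometric f0 f1 B0 _) _; last first.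
    by apply: le_trans (expR_ge1Dx _) _; rewrite ler_expR lerDl.
  move=> k k2n; apply: le_trans (fk' k k2n) _.
  have k2 : (2 <= k)%N by case/andP: k2n.
  rewrite (_ : 8 * _ = 2 * (4 * u ^+ 2)); last by rewrite mulrA -natrM.
  rewrite -mulrA ler_pM2l//.
  apply: (@le_trans _ _ (u ^+ k)).
    rewrite lerXn2r ?nnegrE ?mulr_ge0 ?powR_ge0// ler_piMr//.
    by rewrite powR_nat_le1 ?oppr_le0 ?(ltW r0)// (leq_trans _ k2).
  have -> : 4 * u ^+ 2 * 2^-1 ^+ k = u ^+ 2 * 2^-1 ^+ (k - 2).
    rewrite -[in LHS](subnKC k2) exprD; set z := _ ^+ (k - 2); by field.
  rewrite -[in u ^+ k](subnKC k2) exprD ler_wpM2l ?sqr_ge0//.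
  by rewrite lerXn2r// nnegrE invr_ge0.
(* For [u > 1 / 2], [8 u^2 > 2] gives [1 + 2 e^v <= 3 e^v <= exp (8 u^2 + v)]. The k-th term is at
   most [2 e^v 2^-k] because [(2 u k^-r)^k = v^(r k) / k^(r k)], [v^(r k) <= (r k)^(r k) e^v] and
   [r < 1]. *)
have B0 : 0 <= 2 * expR v by rewrite mulr_ge0// expR_ge0.
apply: le_trans (sum_le_geometric f0 f1 B0 _) _; last first.
  rewrite expRD; apply: (@le_trans _ _ (3 * expR v)).
    have : 1 <= expR v by apply: le_trans (expR_ge1Dx _); rewrite lerDl.
    by lra.
  rewrite ler_wpM2r ?expR_ge0//; apply: le_trans (expR_ge1Dx _).
  by have : 0 <= (u - 2^-1) := ltW _; nra.
move=> k k2n; apply: le_trans (fk' k k2n) _.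
have k2 : (2 <= k)%N by case/andP: k2n.
have k0 : 0 < k%:R :> R by rewrite ltr0n (leq_trans _ k2).
rewrite -[leRHS]mulrA ler_pM2l//.
have -> : u * k%:R `^ (- r) = 2^-1 * (2 * u * k%:R `^ (- r)) by field.
rewrite exprMn mulrC ler_wpM2r ?exprn_ge0 ?invr_ge0//.
have -> : (2 * u * k%:R `^ (- r)) ^+ k = v `^ (r * k%:R) / k%:R `^ (r * k%:R).
  rewrite exprMn powRN exprVn; congr (_ / _); last first.
    by rewrite powRrM powR_mulrn ?powR_ge0.
  rewrite /v -powRrM (_ : q * (r * k%:R) = k%:R); last first.
    by rewrite /q mulrA mulVf ?mul1r// gt_eqF.
  by rewrite powR_mulrn// mulr_ge0.
rewrite ler_pdivrMr ?powR_gt0// [leRHS]mulrC.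
apply: le_trans (powR_le_expR _ v0) _; first by rewrite mulr_ge0 ?ltW.
rewrite ler_wpM2r ?expR_ge0// ge0_ler_powR ?nnegrE
  ?(mulr_ge0 (ltW r0) (ltW k0)) ?(ltW k0)//.
by rewrite ler_piMl// ?(ltW k0)// /r gerBl ltW.
Qed.

(** * Orlicz norms and moments *)

Section orlicz.
Context d (T : measurableType d) (R : realType) (P : probability T R).
Implicit Types (Y : T -> R) (r s eta h : R).

Lemma measurable_orlicz_integrand r eta Y : measurable_fun setT Y ->
  measurable_fun setT (fun w => (expR ((`|Y w| / eta) `^ r))%:E).
Proof.
move=> mY; apply/measurable_EFinP/measurableT_comp => //.
apply: (measurableT_comp (measurable_powR r)).
by apply: measurable_funM => //; exact: measurableT_comp.
Qed.

Lemma orlicz_norm_ge0 r Y : (0 <= orlicz_norm P r Y)%E.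
Proof.
by apply: le_ereal_inf_tmp => _ [eta [eta0 _] <-]; rewrite lee_fin ltW.
Qed.

Lemma orlicz_norm_lt r eta Y : 0 <= r -> measurable_fun setT Y ->
  (orlicz_norm P r Y < eta%:E)%E ->
  0 < eta /\ ('E_P[fun w => expR ((`|Y w| / eta) `^ r)] <= 2%:E)%E.
Proof.
move=> r0 mY /ereal_inf_lt[_ [eta' [eta'0 Eeta'] <-]]; rewrite lte_fin => lteta.
have eta0 : 0 < eta by exact: lt_trans lteta.
split; first exact: eta0.
apply: le_trans Eeta'; rewrite unlock.
apply: ge0_le_integral; first exact: measurableT.
- by move=> w _; rewrite lee_fin expR_ge0.
- exact: measurable_orlicz_integrand.
- exact: measurable_orlicz_integrand.
move=> w _; rewrite lee_fin ler_expR ge0_ler_powR// ?nnegrE ?divr_ge0//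
  ?(ltW eta0) ?(ltW eta'0)//.
by rewrite ler_wpM2l// lef_pV2 ?posrE// ltW.
Qed.

(** Integrate [v^a <= a^a e^v] with [v = (|Y| / eta)^r] and [a = s / r]. *)
Lemma orlicz_powR_moment r s eta Y : 0 < r -> 0 <= s -> 0 < eta ->
  measurable_fun setT Y ->
  ('E_P[fun w => expR ((`|Y w| / eta) `^ r)] <= 2%:E)%E ->
  (\int[P]_w (`|Y w| `^ s)%:E <= (2 * (s / r) `^ (s / r) * eta `^ s)%:E)%E.
Proof.
move=> r0 s0 eta0 mY; rewrite unlock => EY.
set c := (s / r) `^ (s / r) * eta `^ s.
have c0 : 0 <= c by rewrite mulr_ge0 ?powR_ge0.
have -> : 2 * (s / r) `^ (s / r) * eta `^ s = c * 2 by rewrite /c; ring.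
rewrite EFinM; apply: le_trans (lee_wpmul2l _ EY); last by rewrite lee_fin.
rewrite -ge0_integralZl_EFin//; last exact: measurable_orlicz_integrand.
apply: ge0_le_integral => //.
- apply/measurable_EFinP/(measurableT_comp (measurable_powR s)).
  exact: measurableT_comp.
- by apply: measurable_funeM; exact: measurable_orlicz_integrand.
move=> w _; rewrite -EFinM lee_fin.
set z := `|Y w| / eta.
have z0 : 0 <= z by rewrite divr_ge0// ltW.
have -> : `|Y w| = eta * z by rewrite /z mulrCA divff ?mulr1// gt_eqF.
rewrite powRM ?(ltW eta0)// /c mulrAC mulrC ler_wpM2r ?powR_ge0//.
have -> : z `^ s = (z `^ r) `^ (s / r).
  by rewrite -powRrM mulrCA divff ?mulr1// gt_eqF.
by apply: powR_le_expR; rewrite ?powR_ge0// divr_ge0// ltW.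
Qed.

Lemma orlicz_integrable_expr r Y k : 0 < r -> measurable_fun setT Y ->
  (orlicz_norm P r Y < +oo)%E ->
  P.-integrable setT (fun w => (Y w ^+ k)%:E).
Proof.
move=> r0 mY /ereal_inf_lt[_ [eta [eta0 EY] <-] _].
apply/integrableP; split; first exact/measurable_EFinP/measurable_funX.
apply: le_lt_trans (ltry (2 * (k%:R / r) `^ (k%:R / r) * eta `^ k%:R)).
apply: le_trans (orlicz_powR_moment r0 (ler0n R k) eta0 mY EY).
rewrite le_eqVlt; apply/orP; left; apply/eqP.
by apply: eq_integral => w _; rewrite /= normrX powR_mulrn.
Qed.

(** The exponential moment is controlled at every [eta] above the norm [b], and [b] may be 0. The
    moment bound is therefore proved for each [eta > b], put in the form [y^(1/k) <= eta], and
    passed to the limit [eta = b]. *)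
Lemma orlicz_moment_le h Y k : 0 < h -> measurable_fun setT Y ->
  (orlicz_norm P h^-1 Y < +oo)%E -> (0 < k)%N ->
  `|\int[P]_w (Y w ^+ k)| <=
    moment_cst h k * fine (orlicz_norm P h^-1 Y) ^+ k.
Proof.
move=> h0 mY fY k0; set b := fine _.
have b0 : 0 <= b by rewrite fine_ge0// orlicz_norm_ge0.
have bE : (orlicz_norm P h^-1 Y = b%:E)%E.
  by rewrite fineK// ge0_fin_numE// orlicz_norm_ge0.
have hi : 0 < h^-1 by rewrite invr_gt0.
have iY := orlicz_integrable_expr k hi mY fY.
have K0 : 0 < moment_cst h k.
  by rewrite mulr_gt0// powR_gt0// mulr_gt0// ltr0n.
set x := `|_|.
have xle eta : b < eta -> x <= moment_cst h k * eta ^+ k.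
  move=> beta.
  have [eta0 EY] : 0 < eta /\
      ('E_P[fun w => expR ((`|Y w| / eta) `^ h^-1)] <= 2%:E)%E.
    by apply: orlicz_norm_lt => //; rewrite ?(ltW hi)// bE lte_fin.
  apply: le_trans (le_normr_Rintegral measurableT iY) _.
  have iaY : P.-integrable setT (fun w => (`|Y w ^+ k|)%:E).
    exact: (integrable_abse iY).
  rewrite -lee_fin /Rintegral fineK; last exact: integrable_fin_num.
  have := orlicz_powR_moment hi (ler0n R k) eta0 mY EY.
  rewrite invrK powR_mulrn ?(ltW eta0)//; apply: le_trans.
  rewrite le_eqVlt; apply/orP; left; apply/eqP.
  by apply: eq_integral => w _; rewrite /= normrX powR_mulrn.
rewrite -ler_pdivrMl//; set y := _ * x.
have y0 : 0 <= y by rewrite mulr_ge0 ?normr_ge0// invr_ge0 ltW.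
have kR : (0 : R) < k%:R by rewrite ltr0n.
have yk : (y `^ k%:R^-1) ^+ k = y.
  by rewrite -powR_mulrn ?powR_ge0// -powRrM mulVf ?powRr1// gt_eqF.
rewrite -yk lerXn2r ?nnegrE ?powR_ge0//.
apply/unstable.ler_gtP => eta beta.
have eta0 : 0 <= eta by exact/ltW/(le_lt_trans b0).
rewrite -(ler_pXn2r k0) ?nnegrE ?powR_ge0// yk ler_pdivrMl//.
exact: xle.
Qed.

End orlicz.

(* With r = 2 / p and m = E |X|^p, (| |X|^p - m | / B)^r is at most
   th (X^2 / eta^2 + M) with th = 4 eta^2 / B^r and
   M = (2 (p / 2)^(p / 2))^r >= (m / eta^p)^r, and e^(th v) <= 1 - th + th e^v;
   the bound B makes th e^M = 1 / 2. *)
Definition centered_bound (R : realType) (p eta : R) : R :=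
  (8 * eta ^+ 2 * expR ((2 * (p / 2) `^ (p / 2)) `^ (2 / p))) `^ (p / 2).

Lemma orlicz_norm_centered_power_le d (T : measurableType d) (R : realType)
    (P : probability T R) (p eta : R) (X : T -> R) : 1 <= p -> 0 < eta ->
  measurable_fun setT X ->
  ('E_P[fun w => expR ((`|X w| / eta) `^ 2)] <= 2%:E)%E ->
  let Y := fun w => `|X w| `^ p in
  P.-integrable setT (EFin \o Y) /\
  (orlicz_norm P (2 / p) (fun w => (Y w - mean P Y)%R) <=
    (centered_bound p eta)%:E)%E.
Proof.
move=> p1 eta0 mX EX Y0; have p0 : 0 < p by exact: lt_le_trans p1.
have mXp : measurable_fun setT (fun w => `|X w| `^ p).
  by apply: (measurableT_comp (measurable_powR p)); exact: measurableT_comp.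
have ixp := orlicz_powR_moment (ltr0n R 2) (ltW p0) eta0 mX EX.
have iX : P.-integrable setT (fun w => (`|X w| `^ p)%:E).
  apply/integrableP; split; first exact/measurable_EFinP.
  apply: le_lt_trans (ltry _); apply: le_trans ixp.
  rewrite le_eqVlt; apply/orP; left; apply/eqP.
  by apply: eq_integral => w _; rewrite /= ger0_norm ?powR_ge0.
split=> //.
rewrite /Y0; set m := mean _ _.
have m0 : 0 <= m.
  rewrite /m /mean unlock; apply/fine_ge0/integral_ge0 => w _.
  by rewrite lee_fin powR_ge0.
have mle : m <= 2 * (p / 2) `^ (p / 2) * eta `^ p.
  rewrite -lee_fin /m /mean unlock fineK//; exact: integrable_fin_num.
set c := 2 * (p / 2) `^ (p / 2) in mle *.
have c0 : 0 <= c by rewrite mulr_ge0 ?powR_ge0.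
set r := 2 / p; have r0 : 0 < r by rewrite divr_gt0.
have pr : p * r = 2 by rewrite /r mulrCA divff ?mulr1// gt_eqF.
have p2r : p / 2 * r = 1 by rewrite mulrAC pr divff.
have r2 : r <= 2 by rewrite ler_pdivrMr// ler_peMr.
set M := c `^ r; have M0 : 0 <= M by exact: powR_ge0.
set B := centered_bound p eta.
have B1 : 0 < 8 * eta ^+ 2 * expR M by rewrite !mulr_gt0 ?exprn_gt0 ?expR_gt0.
have B0 : 0 < B by exact: powR_gt0.
have Br : B `^ r = 8 * eta ^+ 2 * expR M.
  by rewrite /B /centered_bound -/r -/c -/M -powRrM p2r powRr1// ltW.
apply: ereal_inf_lbound; exists B; last by [].
split; first exact: B0.
set Y := fun w => `|X w| `^ p - m.
have mY : measurable_fun setT Y by exact: measurable_funB.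
set th := (2 * expR M)^-1.
have eM : 1 <= expR M by apply: le_trans (expR_ge1Dx M); rewrite lerDl.
have th0 : 0 < th by rewrite invr_gt0 mulr_gt0 ?expR_gt0.
have th1 : th <= 1 by rewrite invf_le1 ?mulr_gt0 ?expR_gt0//; lra.
have convexE v : expR (th * v) <= 1 - th + th * expR v.
  have := @convex_expR R (Itv01 (ltW th0) th1) v 0.
  by rewrite !convRE/= mulr0 addr0 expR0 mulr1 addrC.
have pt w : expR ((`|Y w| / B) `^ r) <=
    1 - th + th * expR M * expR ((`|X w| / eta) `^ 2).
  set u := `|X w| / eta.
  have u0 : 0 <= u by rewrite divr_ge0// ltW.
  have Xu : `|X w| = eta * u by rewrite /u mulrCA divff ?mulr1// gt_eqF.
  rewrite -mulrA -expRD.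
  apply: le_trans (convexE _); rewrite ler_expR.
  rewrite powRM ?invr_ge0 ?(ltW B0)// -powR_inv1 ?(ltW B0)// -powRrM mulN1r powRN Br.
  rewrite ler_pdivrMr// /th.
  have -> : (2 * expR M)^-1 * (M + u `^ 2) * (8 * eta ^+ 2 * expR M) =
            4 * (eta ^+ 2 * u `^ 2 + eta ^+ 2 * M).
    by have := expR_gt0 M; move: (expR M) => e e0; field; rewrite gt_eqF.
  (* Bound [x + y] by twice the maximum; [p >= 1] gives [r <= 2], hence [2^r <= 4]. This is the 4 in
     [th = 4 eta^2 / B^r]. *)
  have maxr (x y : R) : 0 <= x -> 0 <= y -> (x + y) `^ r <= 4 * (x `^ r + y `^ r).
    wlog : x y / x <= y.
      move=> wl x0 y0; have [xy|/ltW yx] := leP x y; first exact: wl.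
      by rewrite addrC [_ `^ r + _]addrC wl.
    move=> xy x0 y0; apply: (@le_trans _ _ ((2 * y) `^ r)).
      by apply: ge0_ler_powR; rewrite ?nnegrE ?(ltW r0)//; lra.
    rewrite powRM//; have y2 : 2 `^ r <= 4 :> R.
      apply: le_trans (ler_powR _ r2) _ => //; first by rewrite ler1n.
      by rewrite powR_mulrn// -natrX.
    have := powR_ge0 x r; have := powR_ge0 y r; nra.
  apply: (@le_trans _ _ ((`|X w| `^ p + m) `^ r)).
    rewrite ge0_ler_powR ?nnegrE ?addr_ge0 ?powR_ge0 ?(ltW r0)//.
    rewrite /Y (le_trans (ler_normB _ _))//.
    by rewrite (ger0_norm (powR_ge0 _ _)) (ger0_norm m0).
  apply: le_trans (maxr _ _ (powR_ge0 _ _) m0) _.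
  rewrite ler_pM2l// lerD//.
    by rewrite -powRrM pr Xu powRM ?(ltW eta0)// [eta `^ 2]powR_mulrn// ltW.
  apply: (@le_trans _ _ ((c * eta `^ p) `^ r)).
    by apply: ge0_ler_powR; rewrite ?nnegrE ?(ltW r0)// mulr_ge0 ?powR_ge0.
  by rewrite powRM ?powR_ge0// -powRrM pr powR_mulrn ?(ltW eta0)// mulrC.
pose E2 := fun w => expR ((`|X w| / eta) `^ 2).
have mE2 : measurable_fun setT (EFin \o E2) by exact: measurable_orlicz_integrand.
have tM : th * expR M = 2^-1.
  by rewrite /th; have := expR_gt0 M; move: (expR M) => e e0; field; rewrite gt_eqF.
rewrite unlock.
apply: (@le_trans _ _ (\int[P]_w ((1 - th)%:E + 2^-1%:E * (E2 w)%:E))%E).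
  apply: ge0_le_integral; first exact: measurableT.
  - by move=> w _; rewrite lee_fin expR_ge0.
  - exact: measurable_orlicz_integrand.
  - by apply: emeasurable_funD => //; exact: measurable_funeM.
  - by move=> w _; rewrite -EFinM -EFinD lee_fin -tM pt.
rewrite ge0_integralD; last first.
- exact: measurable_funeM.
- move=> w _; apply: mule_ge0; rewrite lee_fin; last exact: expR_ge0.
  by rewrite invr_ge0.
- exact: measurable_cst.
- by move=> w _; rewrite lee_fin subr_ge0.
- exact: measurableT.
rewrite integral_cst; last exact: measurableT.
rewrite [X in (_ * X)%E](_ : _ = 1%E) ?mule1; last exact: probability_setT.
rewrite ge0_integralZl_EFin; last first.
- by rewrite invr_ge0.
- exact: mE2.
- by move=> w _; rewrite lee_fin expR_ge0.
- exact: measurableT.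
move: EX; rewrite unlock => EX.
apply: (@le_trans _ _ ((1 - th)%:E + 2^-1%:E * 2%:E)%E).
  by rewrite leeD2l// lee_wpmul2l// lee_fin invr_ge0.
by rewrite -EFinM -EFinD lee_fin mulVf//; lra.
Qed.

(** * Norms of finite vectors *)

Section lq_norms.
Context (R : realType) (I : finType).
Implicit Types (b : I -> R) (p q : R).

Lemma lq_norm2_sqr b : lq_norm 2%:E b ^+ 2 = \sum_i `|b i| ^+ 2.
Proof.
rewrite /lq_norm powR12_sqrt; last by apply: sumr_ge0 => i _; exact: powR_ge0.
rewrite sqr_sqrtr; last by apply: sumr_ge0 => i _; exact: powR_ge0.
by apply: eq_bigr => i _; rewrite powR_mulrn.
Qed.

Lemma lq_norm_ge0 q b : 0 <= lq_norm q%:E b.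
Proof. exact: powR_ge0. Qed.

Lemma lq_norm_dual_light p b : p < 2 ->
  lq_norm (dual_exponent p) b = lq_norm ((1 - p / 2)^-1)%:E b.
Proof.
move=> p2; have h0 : 0 < 1 - p / 2 by lra.
rewrite /dual_exponent /pos_part (max_idPl (ltW h0)) inver.
by rewrite gt_eqF.
Qed.

Lemma lq_norm_dual_heavy p b : 2 <= p ->
  lq_norm (dual_exponent p) b = \big[Num.max/0]_i `|b i|.
Proof.
move=> p2; have h0 : 1 - p / 2 <= 0 by lra.
by rewrite /dual_exponent /pos_part (max_idPr h0) inver eqxx.
Qed.

Lemma lq_norm_dual_ge0 p b : 0 <= lq_norm (dual_exponent p) b.
Proof.
have [p2|p2] := ltP p 2; first by rewrite lq_norm_dual_light// lq_norm_ge0.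
rewrite lq_norm_dual_heavy//.
by apply: (big_ind (fun x : R => 0 <= x)) => // x y x0 y0; rewrite le_max x0.
Qed.

Lemma lq_norm_powR q b : 0 < q -> \sum_i `|b i| `^ q = lq_norm q%:E b `^ q.
Proof.
move=> q0; rewrite /lq_norm -powRrM mulVf ?gt_eqF// powRr1//.
by apply: sumr_ge0 => i _; exact: powR_ge0.
Qed.

Lemma le_lq_norm_dual_heavy p b i : 2 <= p -> `|b i| <= lq_norm (dual_exponent p) b.
Proof. by move=> p2; rewrite lq_norm_dual_heavy// (bigD1 i)//= le_max lexx. Qed.

Lemma lq_norm_le q b (B : R) : 0 < q -> 0 <= B -> (forall i, `|b i| <= B) ->
  lq_norm q%:E b <= B * #|I|%:R `^ q^-1.
Proof.
move=> q0 B0 bB; have qi0 : 0 <= q^-1 by rewrite invr_ge0 ltW.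
apply: (@le_trans _ _ ((B `^ q * #|I|%:R) `^ q^-1)).
  apply: ge0_ler_powR => //; rewrite ?nnegrE.
  - by apply: sumr_ge0 => i _; exact: powR_ge0.
  - by rewrite mulr_ge0// powR_ge0.
  - rewrite mulr_natr -sumr_const; apply: ler_sum => i _.
    by apply: ge0_ler_powR; rewrite ?nnegrE// ltW.
by rewrite powRM ?powR_ge0// -powRrM divff ?gt_eqF// powRr1.
Qed.

(** The exponent of the cardinality is the inverse of the dual exponent, read as 0 for the sup norm.
    With a common bound [B] this produces the power of D in the identically distributed case; with
    [B = 0] it shows that the norm of a zero vector vanishes. *)
Lemma lq_norm_dual_le p b (B : R) : 0 <= B -> (forall i, `|b i| <= B) ->
  lq_norm (dual_exponent p) b <= B * #|I|%:R `^ pos_part (1 - p / 2).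
Proof.
move=> B0 bB; have [p2|p2] := ltP p 2.
  have h0 : 0 < 1 - p / 2 by lra.
  rewrite lq_norm_dual_light// /pos_part (max_idPl (ltW h0)).
  by apply: le_trans (lq_norm_le _ B0 bB) _; rewrite ?invr_gt0// invrK.
have h0 : 1 - p / 2 <= 0 by lra.
rewrite lq_norm_dual_heavy// /pos_part (max_idPr h0) powRr0 mulr1.
by apply: (big_ind (fun x : R => x <= B)) => // x y xB yB; rewrite ge_max xB.
Qed.

End lq_norms.

(** * Product of the moment series over all coordinates *)

(** The first constraint on [l] gives [\sum_i (l b_i)^2 <= n]. For [p < 2] the second gives
    [\sum_i (l b_i)^q <= n], since [(n^(1 - h))^q = n]; the two sums explain the witness [2 * A].
    For [p >= 2] it bounds each [l b_i n^(h - 1)] by [c] through the sup norm. *)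
Lemma prod_moment_series_le (R : realType) (p : R) : 1 <= p ->
  exists A c : R, [/\ 0 < A, 0 < c &
    forall (I : finType) (n : nat) (b : I -> R) (l : R) (mu : I -> nat -> R),
    (0 < n)%N -> (forall i, 0 <= b i) -> 0 <= l ->
    (forall i, mu i 0%N = 1) -> (forall i, mu i 1%N = 0) ->
    (forall i k, (2 <= k)%N -> `|mu i k| <= moment_cst (p / 2) k * b i ^+ k) ->
    l * lq_norm 2%:E b <= Num.sqrt n%:R ->
    l * lq_norm (dual_exponent p) b <= c * n%:R `^ (1 - p / 2) ->
    \prod_i \sum_(k < n.+1) l ^+ k * `|mu i k| / k`!%:R <= expR (A * n%:R)].
Proof.
move=> p1; set h := p / 2.
have l2_le (I : finType) (n : nat) (b : I -> R) (l : R) : 0 <= l ->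
    (forall i, 0 <= b i) -> l * lq_norm 2%:E b <= Num.sqrt n%:R ->
    \sum_i (l * b i) ^+ 2 <= n%:R.
  move=> l0 b0 lb; under eq_bigr do rewrite exprMn -(ger0_norm (b0 _)).
  rewrite -mulr_sumr -lq_norm2_sqr -exprMn -[leRHS]sqr_sqrtr//.
  by rewrite lerXn2r ?nnegrE ?sqrtr_ge0// mulr_ge0// lq_norm_ge0.
have term (n : nat) (b l : R) (mu : nat -> R) : 0 <= l -> 0 <= b ->
    (forall k, (2 <= k)%N -> `|mu k| <= moment_cst h k * b ^+ k) ->
    forall k, (2 <= k <= n)%N ->
      l ^+ k * `|mu k| / k`!%:R <= moment_cst h k * (l * b) ^+ k / k`!%:R.
  move=> l0 b0 muK k /andP[k2 _]; rewrite ler_wpM2r// exprMn mulrCA.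
  by rewrite ler_wpM2l ?exprn_ge0// muK.
have [p2|p2] := ltP p 2.
  have hh : 2^-1 <= h < 1 by rewrite /h; apply/andP; split; lra.
  have [A [A0 HA]] := moment_series_le_light hh.
  exists (2 * A), 1; split=> //; first by rewrite mulr_gt0.
  move=> I n b l mu n0 b0 l0 mu0 mu1 muK l2 lq.
  set q := (1 - h)^-1.
  have q0 : 0 < q by rewrite invr_gt0 subr_gt0; case/andP: hh.
  apply: (@le_trans _ _ (\prod_i expR (A * ((l * b i) ^+ 2 + (l * b i) `^ q)))).
    apply: ler_prod => i _; apply/andP; split.
      by apply: sumr_ge0 => k _; rewrite divr_ge0// mulr_ge0// exprn_ge0.
    apply: (HA n (l * b i) (fun k => l ^+ k * `|mu i k| / k`!%:R)).
    - by rewrite mulr_ge0.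
    - by rewrite mu0 normr1 expr0 mulr1 divr1.
    - by rewrite mu1 normr0 mulr0 mul0r.
    - by apply: term => // k; exact: muK.
  rewrite -expR_sum ler_expR -mulr_sumr big_split /= -mulrA mulrCA.
  rewrite ler_wpM2l ?(ltW A0)//.
  rewrite mulr_natl mulr2n lerD//; first exact: l2_le.
  under eq_bigr do rewrite powRM//.
  rewrite -mulr_sumr.
  under eq_bigr do rewrite -(ger0_norm (b0 _)).
  rewrite lq_norm_powR// -powRM//; last exact: lq_norm_ge0.
  rewrite lq_norm_dual_light// mul1r in lq.
  have -> : n%:R = (n%:R `^ (1 - h)) `^ q :> R.
    rewrite -powRrM divff ?powRr1// subr_eq0 gt_eqF//; by case/andP: hh.
  apply: ge0_ler_powR; rewrite ?nnegrE ?powR_ge0//; first exact: ltW.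
  by rewrite mulr_ge0// lq_norm_ge0.
have h1 : 1 <= h by rewrite /h ler_pdivlMr// mul1r.
have [A [c [A0 c0 HA]]] := moment_series_le_heavy h1.
exists A, c; split=> // I n b l mu n0 b0 l0 mu0 mu1 muK l2 lq.
apply: (@le_trans _ _ (\prod_i expR (A * (l * b i) ^+ 2))).
  apply: ler_prod => i _; apply/andP; split.
    by apply: sumr_ge0 => k _; rewrite divr_ge0// mulr_ge0// exprn_ge0.
  apply: (HA n (l * b i) (fun k => l ^+ k * `|mu i k| / k`!%:R)).
    - by rewrite mulr_ge0.
  - have nh : 0 < n%:R `^ (h - 1) :> R by rewrite powR_gt0// ltr0n.
    rewrite -ler_pdivlMr// -powRN opprB; apply: le_trans lq.
    by rewrite ler_wpM2l// -[leLHS](ger0_norm (b0 i)) le_lq_norm_dual_heavy.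
  - by rewrite mu0 normr1 expr0 mulr1 divr1.
  - by rewrite mu1 normr0 mulr0 mul0r.
  - by apply: term => // k; exact: muK.
rewrite -expR_sum ler_expR -mulr_sumr ler_wpM2l ?(ltW A0)//.
exact: l2_le.
Qed.

(** * Tail bounds from even moments *)

Section tails.
Context d (T : measurableType d) (R : realType) (P : probability T R).
Variable S : T -> R.
Hypothesis mS : measurable_fun setT S.

Lemma measurable_ge_norm t : measurable [set w | (t <= `|S w|)%R].
Proof.
have -> : [set w | t <= `|S w|] = (fun w => `|S w|) @^-1` `[t, +oo[.
  by apply/seteqP; split => w /=; rewrite in_itv/= andbT.
rewrite -[_ @^-1` _]setTI.
have mN : measurable_fun setT (fun w => `|S w|) by exact: measurableT_comp.
exact: mN.
Qed.

Lemma measurable_gt_norm t : measurable [set w | (t < `|S w|)%R].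
Proof.
have -> : [set w | t < `|S w|] = (fun w => `|S w|) @^-1` `]t, +oo[.
  by apply/seteqP; split => w /=; rewrite in_itv/= andbT.
rewrite -[_ @^-1` _]setTI.
have mN : measurable_fun setT (fun w => `|S w|) by exact: measurableT_comp.
exact: mN.
Qed.

(** An even power is nonnegative, so Markov's inequality applies to the signed moment, the one that
    the expansion controls. *)
Lemma markov_even_power (n : nat) t : ~~ odd n -> 0 < t ->
  P.-integrable setT (fun w => (S w ^+ n)%:E) ->
  (P [set w | (t <= `|S w|)%R] <= ((\int[P]_w (S w ^+ n)) / t ^+ n)%:E)%E.
Proof.
move=> on t0 iS; have tn0 : 0 < t ^+ n by rewrite exprn_gt0.
rewrite mulrC EFinM /Rintegral fineK; last exact: integrable_fin_num.
rewrite -(setIT [set w | _]) -integral_indic; last 2 first.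
- exact: measurableT.
- exact: measurable_ge_norm.
have Sn0 w : 0 <= S w ^+ n by exact: exprn_even_ge0.
rewrite -ge0_integralZl_EFin; last first.
- by rewrite invr_ge0 ltW.
- exact/measurable_EFinP/measurable_funX.
- by move=> w _; rewrite lee_fin.
- exact: measurableT.
apply: ge0_le_integral; first exact: measurableT.
- by move=> w _; rewrite lee_fin.
- by apply/measurable_EFinP/measurable_indic; exact: measurable_ge_norm.
- by apply: measurable_funeM; exact/measurable_EFinP/measurable_funX.
move=> w _; rewrite -EFinM lee_fin indicE; case: (w \in _) / boolP => tw; last first.
  by rewrite mulr_ge0// invr_ge0 ltW.
rewrite inE /= in tw; rewrite ler_pdivlMl// mulr1.
rewrite -(ger0_norm (Sn0 w)) normrX lerXn2r// nnegrE//; exact: ltW.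
Qed.

End tails.

Lemma fact_le_expn n : (n`! <= n ^ n)%N.
Proof.
elim: n => // n IH; rewrite factS expnS leq_mul// (leq_trans IH)//.
by case: n {IH} => // n; rewrite leq_exp2r.
Qed.

Lemma le1_2expRN (R : realType) (x : R) : x <= 2^-1 -> 1 <= 2 * expR (- x).
Proof. by move=> x2; have := expR_ge1Dx (- x); lra. Qed.

(** If all [b i] vanish then [t = 0] and the event [t <= |S|] is the whole space, which violates the
    bound for large [x]. Hence the non-strict bound assumes a nonzero [b i], while the strict one
    always holds. *)
Lemma powR_sum_tail (R : realType) (p : R) : 1 <= p ->
  exists d1 d2 : R, [/\ 0 < d1, 0 < d2 &
    forall (d : measure_display) (T : measurableType d) (P : probability T R)
      (I : finType) (X : I -> {RV P >-> R}) (g : I -> R -> R) (b : I -> R),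
    mutually_independent P (fun i => X i : T -> R) ->
    (forall i, measurable_fun setT (g i)) ->
    (forall i k, P.-integrable setT (fun w => (g i (X i w) ^+ k)%:E)) ->
    (forall i, 0 <= b i) ->
    (forall i, \int[P]_w g i (X i w) = 0) ->
    (forall i k, (2 <= k)%N -> `|\int[P]_w (g i (X i w) ^+ k)| <=
       moment_cst (p / 2) k * b i ^+ k) ->
    forall x : R, 0 < x ->
    let S w := \sum_i g i (X i w) in
    let t : R := d1 * lq_norm 2%:E b * Num.sqrt x
                 + d2 * lq_norm (dual_exponent p) b * x `^ (p / 2) in
    ((exists i, b i != 0) ->
       (P [set w | (t <= `|S w|)%R] <= (2 * expR (- x))%:E)%E) /\
    (P [set w | (t < `|S w|)%R] <= (2 * expR (- x))%:E)%E].
Proof.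
move=> p1; have [A [c [A0 c0 HA]]] := prod_moment_series_le p1.
set h := p / 2; set E := expR (A + 1).
have E0 : 0 < E by exact: expR_gt0.
have h0 : 0 < h by rewrite divr_gt0// (lt_le_trans _ p1).
(* The 6 comes from [n <= 6 x] below. In [E = exp (A + 1)], the [A] compensates the product bound
   [exp (A n)] and the 1 leaves [exp (- n)]. *)
exists (E * Num.sqrt 6), (E * 6 `^ h / c); split.
- by rewrite mulr_gt0// sqrtr_gt0.
- by rewrite divr_gt0// mulr_gt0// powR_gt0.
move=> d T P I X g b indX mg ig b0 g1 gk x x0 S t.
have mS : measurable_fun setT S.
  apply: measurable_sum => i.
  exact: (measurableT_comp (mg i) (measurable_funP (X i))).
set N2 := lq_norm 2%:E b; set Nq := lq_norm (dual_exponent p) b.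
have N20 : 0 <= N2 by exact: lq_norm_ge0.
have Nq0 : 0 <= Nq by exact: lq_norm_dual_ge0.
pose M i k := \int[P]_w (g i (X i w) ^+ k).
have M0 i : M i 0%N = 1.
  by rewrite /M; under eq_Rintegral do rewrite expr0; exact: Rintegral_one.
have M1 i : M i 1%N = 0.
  by rewrite /M; under eq_Rintegral do rewrite expr1; exact: g1.
have e2 : 0 <= 2 * expR (- x) by rewrite mulr_ge0// expR_ge0.
have ge_le : (P [set w | (t <= `|S w|)%R] <= (2 * expR (- x))%:E)%E ->
    (P [set w | (t < `|S w|)%R] <= (2 * expR (- x))%:E)%E.
  apply: le_trans; apply: le_measure; rewrite ?inE.
  - exact: measurable_gt_norm.
  - exact: measurable_ge_norm.
  - by move=> w /= /ltW.
have [/existsP[i bi]|/existsPn nb] := boolP [exists i, b i != 0].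
  suff : (P [set w | (t <= `|S w|)%R] <= (2 * expR (- x))%:E)%E.
    by move=> H; split=> [_|]; [exact: H|exact: ge_le].
  have N2gt : 0 < N2.
    rewrite lt_neqAle N20 andbT eq_sym; apply/eqP => N2E.
    have := lq_norm2_sqr b; rewrite -/N2 N2E expr0n /= => /esym/eqP.
    rewrite psumr_eq0; last by move=> j _; exact: sqr_ge0.
    move=> /allP/(_ i (mem_index_enum _)); rewrite /= sqrf_eq0 normr_eq0.
    exact/negP.
  (* For [x <= 1 / 2] the right side is at least 1. Otherwise the even number [n = 2 (truncn x + 1)]
     satisfies [x <= n <= 2 x + 2 <= 6 x]. *)
  have [x2|x2] := leP x 2^-1.
    apply: le_trans (probability_le1 _ (measurable_ge_norm mS t)) _.
    by rewrite lee_fin le1_2expRN.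
  set m := (Num.truncn x).+1; set n := (2 * m)%N.
  have n0 : (0 < n)%N by [].
  have nR : 0 < n%:R :> R by rewrite ltr0n.
  have xn : x <= n%:R.
    apply: (@le_trans _ _ m%:R); first exact/ltW/truncnS_gt.
    by rewrite ler_nat /n leq_pmull.
  have n6 : n%:R <= 6 * x.
    rewrite /n natrM /m -natr1; have := truncn_le x.
    by rewrite (ltW x0); lra.
  have on : ~~ odd n by rewrite /n oddM.
  pose sn : R := Num.sqrt n%:R; have sn0 : 0 < sn by rewrite sqrtr_gt0.
  (* With [l = 1 / z], each summand of [z] secures one of the two constraints on [l]. Positivity of
     [z] rests on [N2 > 0]. *)
  set z := N2 / sn + Nq * n%:R `^ (h - 1) / c.
  have zq : 0 <= Nq * n%:R `^ (h - 1) / c.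
    by rewrite divr_ge0 ?(ltW c0)// mulr_ge0// powR_ge0.
  have z0 : 0 < z by rewrite ltr_wpDr// divr_gt0.
  set l := z^-1; have l0 : 0 < l by rewrite invr_gt0.
  have [iS] := independent_sum_moment_le indX mg ig n l0.
  have := HA I n b l M n0 b0 (ltW l0) M0 M1 gk.
  rewrite -/N2 -/Nq -/h -/sn => HP.
  have {}HP : \prod_i \sum_(k < n.+1) l ^+ k * `|M i k| / k`!%:R <= expR (A * n%:R).
    apply: HP.
    - by rewrite /l ler_pdivrMl// mulrC -ler_pdivrMl// mulrC /z lerDl.
    - rewrite /l ler_pdivrMl// /z mulrDl.
      have -> : Nq * n%:R `^ (h - 1) / c * (c * n%:R `^ (1 - h)) = Nq.
        have -> : n%:R `^ (1 - h) = (n%:R `^ (h - 1))^-1 :> R.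
          by rewrite -powRN opprB.
        by field; rewrite !gt_eqF// powR_gt0.
      by rewrite lerDr mulr_ge0// ?divr_ge0 ?(ltW sn0)// mulr_ge0 ?powR_ge0// ltW.
  move=> Sle.
  (* At this level the moment bound [n^n z^n exp (A n)] divided by [tau^n] is exactly [exp (- n)],
     and [n <= 6 x] gives [tau <= t]. *)
  set tau := E * n%:R * z.
  have tau0 : 0 < tau by rewrite mulr_gt0// mulr_gt0.
  have tau_t : tau <= t.
    rewrite /tau /t -/N2 -/Nq -/h /z -mulrA mulrDr mulrDr lerD//.
      have -> : n%:R * (N2 / sn) = N2 * sn.
        rewrite -[n%:R](sqr_sqrtr (ltW nR)) -/sn; by field; rewrite gt_eqF.
      rewrite -!mulrA ler_pM2l// mulrCA ler_wpM2l// -sqrtrM//.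
      exact: ler_wsqrtr.
    have -> : n%:R * (Nq * n%:R `^ (h - 1) / c) = Nq / c * n%:R `^ h.
      rewrite -(mulr_powRB1 (ltW nR) h0); ring.
    have -> : E * 6 `^ h / c * Nq * x `^ h =
        E * (Nq / c * (6 `^ h * x `^ h)) by ring.
    rewrite ler_pM2l// ler_wpM2l ?divr_ge0 ?(ltW c0)// -powRM ?(ltW x0)//.
    by apply: ge0_ler_powR; rewrite ?nnegrE ?(ltW h0) ?(ltW nR)// mulr_ge0// ltW.
  apply: (@le_trans _ _ (P [set w | (tau <= `|S w|)%R])).
    apply: le_measure; rewrite ?inE.
    - exact: measurable_ge_norm.
    - exact: measurable_ge_norm.
    - by move=> w /=; exact: le_trans.
  apply: le_trans (markov_even_power mS on tau0 iS) _; rewrite lee_fin.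
  apply: (@le_trans _ _ (expR (- x))); last first.
    by rewrite ler_peMl ?expR_ge0// ler1n.
  rewrite ler_pdivrMr ?exprn_gt0//.
  apply: le_trans (ler_norm _) _; apply: le_trans Sle _.
  have fn : n`!%:R <= n%:R ^+ n :> R by rewrite -natrX ler_nat fact_le_expn.
  apply: (@le_trans _ _ (n%:R ^+ n * z ^+ n * expR (A * n%:R))).
    rewrite /l exprVn invrK ler_pM// ?mulr_ge0 ?exprn_ge0 ?(ltW z0)//.
      apply: prodr_ge0 => j _; apply: sumr_ge0 => k _.
      by rewrite divr_ge0// mulr_ge0// exprn_ge0// ltW.
    by rewrite ler_wpM2r// exprn_ge0// ltW.
  have -> : tau ^+ n = expR n%:R * (n%:R ^+ n * z ^+ n * expR (A * n%:R)).
    rewrite /tau !exprMn /E -expRM_natr mulrDl mul1r expRD; ring.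
  rewrite [leRHS]mulrA -expRD; apply: ler_peMl.
    apply: mulr_ge0 (expR_ge0 _); apply: mulr_ge0; apply: exprn_ge0 => //.
    exact: ltW.
  by rewrite -[leLHS]expR0 ler_expR addrC subr_ge0.
have {}nb i : b i = 0 by have := nb i; rewrite negbK => /eqP.
split=> [[i]|]; first by rewrite nb eqxx.
have tE : t = 0.
  have bE : b = fun=> 0 by apply/funext.
  have N2E : N2 = 0.
    apply/eqP; rewrite -sqrf_eq0 lq_norm2_sqr big1// => i _.
    by rewrite nb normr0 expr0n.
  have NqE : Nq = 0.
    apply/eqP; rewrite eq_le Nq0 andbT.
    apply: le_trans (lq_norm_dual_le p (lexx 0) _) _; last by rewrite mul0r.
    by move=> i; rewrite nb normr0.
  by rewrite /t -/N2 -/Nq N2E NqE !(mulr0, mul0r) addr0.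
have Mk i k : (2 <= k)%N -> M i k = 0.
  move=> k2; apply/eqP; rewrite -normr_le0; apply: le_trans (gk i k k2) _.
  by rewrite nb expr0n -leqn0 leqNgt (ltnW k2) mulr0.
(* When all [b i] vanish every factor of the product is 1, so the bound holds for every [l]; letting
   [l] grow forces the second moment to be 0. The choice [l = 1 + 2 / v] below makes this
   quantitative. *)
have S2 l : 0 < l -> `|\int[P]_w (S w ^+ 2)| <= 2 * l ^- 2.
  move=> l0; have [_] := independent_sum_moment_le indX mg ig 2 l0.
  rewrite big1 ?mulr1// => i _; rewrite !big_ord_recl big_ord0 /=.
  rewrite -![\int[P]_w _]/(M i _) M0 M1 Mk// !normr0 normr1 expr0 !mulr1 !mulr0.
  by rewrite !mul0r !addr0 divr1.
have [iS _] := independent_sum_moment_le indX mg ig 2 (@ltr01 R).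
have S0 : \int[P]_w (S w ^+ 2) = 0.
  apply/eqP; rewrite -normr_le0 leNgt; apply/negP; set v := `|_| => v0.
  have l0 : 0 < 1 + 2 / v by rewrite addr_gt0// divr_gt0.
  have := S2 _ l0; rewrite -/v leNgt => /negP; apply.
  rewrite ltr_pdivrMr ?exprn_gt0//.
  have y0 : 0 < 2 / v by rewrite divr_gt0.
  have -> : v * (1 + 2 / v) ^+ 2 = v + 4 + 2 * (2 / v).
    by field; rewrite gt_eqF.
  by move: (2 / v) y0 => y y0; lra.
apply: (@le_trans _ _ 0%E); last by rewrite lee_fin.
rewrite tE.
(* The event [0 < |S|] is a countable union of events [1 / (k + 1) <= |S|], each null by Markov's
   inequality. *)
pose F (k : nat) := [set w | (k.+1%:R^-1 <= `|S w|)%R].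
have mF k : measurable (F k) by exact: measurable_ge_norm.
have -> : [set w | (0 < `|S w|)%R] = \bigcup_k F k.
  apply/seteqP; split => w /=.
    move=> Sw; exists (Num.truncn (`|S w|^-1)) => //=.
    rewrite /F /= invf_ple ?posrE//; exact/ltW/truncnS_gt.
  by move=> [k _ /=]; apply: lt_le_trans; rewrite invr_gt0.
apply: le_trans (measure_sigma_subadditive P mF
  (bigcup_measurable (fun k _ => mF k)) (@subset_refl _ _)) _.
rewrite eseries0// => k _ _; apply/eqP; rewrite eq_le measure_ge0 andbT.
  apply: le_trans (markov_even_power mS (n := 2) _ _ iS) _ => //.
  by rewrite S0 mul0r.
Qed.

(** * Centered powers of sub-Gaussian variables *)

Section centered_powers.
Context d (T : measurableType d) (R : realType) (P : probability T R).
Context (I : finType) (p : R) (X : I -> {RV P >-> R}).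
Hypotheses (p1 : 1 <= p) (subX : forall i, sub_gaussian P (X i)).

Let Y i : T -> R := fun w => `|X i w| `^ p.
Let g i : R -> R := fun y => `|y| `^ p - mean P (Y i).
Let b : I -> R := centered_power_norm P p (fun i => X i : T -> R).

Let p0 : 0 < p. Proof. exact: lt_le_trans p1. Qed.

Lemma measurable_centered_power i : measurable_fun setT (g i).
Proof.
apply: measurable_funB => //; apply: (measurableT_comp (measurable_powR p)).
exact: normr_measurable.
Qed.

Let mgX i : measurable_fun setT (fun w => g i (X i w)).
Proof.
exact: (measurableT_comp (measurable_centered_power i) (measurable_funP (X i))).
Qed.

Lemma sub_gaussian_centered_power i :
  P.-integrable setT (EFin \o Y i) /\
  (orlicz_norm P (2 / p) (fun w => g i (X i w)) < +oo)%E.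
Proof.
have /ereal_inf_lt[_ [eta [eta0 EX] <-] _] := subX i.
have [iY le] := orlicz_norm_centered_power_le p1 eta0 (measurable_funP (X i)) EX.
by split=> //; exact: le_lt_trans le (ltry _).
Qed.

Let hi : (p / 2)^-1 = 2 / p. Proof. by rewrite invf_div. Qed.

Lemma integrable_centered_power i k :
  P.-integrable setT (fun w => (g i (X i w) ^+ k)%:E).
Proof.
have [_ fin] := sub_gaussian_centered_power i.
by apply: orlicz_integrable_expr fin; [rewrite divr_gt0|exact: mgX].
Qed.

Let meanE i : mean P (Y i) = \int[P]_w Y i w.
Proof. by rewrite /mean unlock. Qed.

Lemma centered_power_integral0 i : \int[P]_w g i (X i w) = 0.
Proof.
have [iY _] := sub_gaussian_centered_power i.
have ic : P.-integrable setT (EFin \o (fun=> mean P (Y i))).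
  exact: finite_measure_integrable_cst.
rewrite /g (RintegralB measurableT iY ic) -meanE.
by rewrite -[X in _ - \int[_]__ X]mulr1 (RintegralZl (f := fun=> 1))// ?Rintegral_one
  ?mulr1 ?subrr//; exact: finite_measure_integrable_cst.
Qed.

Lemma centered_power_norm_ge0 i : 0 <= b i.
Proof. exact/fine_ge0/orlicz_norm_ge0. Qed.

Lemma centered_power_moment_le i k : (2 <= k)%N ->
  `|\int[P]_w (g i (X i w) ^+ k)| <= moment_cst (p / 2) k * b i ^+ k.
Proof.
move=> k2; have [_ fin] := sub_gaussian_centered_power i.
rewrite -hi in fin.
have := orlicz_moment_le _ (mgX i) fin (ltnW k2).
by rewrite hi; apply; rewrite divr_gt0.
Qed.

Lemma centered_power_sumE w :
  power_sum p (fun i => X i : T -> R) w -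
    mean P (power_sum p (fun i => X i : T -> R)) =
  \sum_i g i (X i w).
Proof.
rewrite sumrB; congr (_ - _).
transitivity (\int[P]_w \sum_i Y i w); first by rewrite /mean unlock.
rewrite Rintegral_sum; last by move=> i; have [] := sub_gaussian_centered_power i.
by apply: eq_bigr => i _; rewrite meanE.
Qed.

End centered_powers.

(** * The general and the identically distributed tail bounds *)

(** In the identically distributed case [0 < #|I|] keeps [t] positive even when [b] vanishes, so the
    non-strict bound holds without a condition on [b]. For an empty index set and [p < 2], [t] would
    be 0 and the event the whole space. *)
Theorem theorem2p3 (R : realType) (p : R) (hp : 1 <= p) :
  (exists d1 d2 : R, [/\ 0 < d1, 0 < d2 &
    forall (d : measure_display) (T : measurableType d) (P : probability T R)
      (I : finType) (xi : I -> {RV P >-> R}),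
    mutually_independent P (fun i => xi i : T -> R) ->
    (forall i, ('E_P[xi i] = 0)%E) ->
    (forall i, sub_gaussian P (xi i)) ->
    let Z : T -> R := power_sum p (fun i => xi i : T -> R) in
    let b : I -> R := centered_power_norm P p (fun i => xi i : T -> R) in
    forall x : R, 0 < x ->
    let t : R := d1 * lq_norm 2%:E b * Num.sqrt x
                 + d2 * lq_norm (dual_exponent p) b * x `^ (p / 2) in
    ((exists i, b i != 0) ->
       (P [set w | (t <= `|Z w - mean P Z|)%R] <= (2 * expR (- x))%:E)%E) /\
    (P [set w | (t < `|Z w - mean P Z|)%R] <= (2 * expR (- x))%:E)%E])
  /\
  (forall K : R, exists c1 c2 : R, [/\ 0 < c1, 0 < c2 &
    forall (d : measure_display) (T : measurableType d) (P : probability T R)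
      (I : finType) (xi : I -> {RV P >-> R}),
    (0 < #|I|)%N ->
    mutually_independent P (fun i => xi i : T -> R) ->
    (forall i, ('E_P[xi i] = 0)%E) ->
    identically_distributed xi ->
    (forall i, orlicz_norm P 2 (xi i) = K%:E) ->
    let Z : T -> R := power_sum p (fun i => xi i : T -> R) in
    forall x : R, 0 < x ->
    let t : R := c1 * Num.sqrt (#|I|%:R * x)
                 + c2 * #|I|%:R `^ pos_part (1 - p / 2) * x `^ (p / 2) in
    (P [set w | (t <= `|Z w - mean P Z|)%R] <= (2 * expR (- x))%:E)%E]).
Proof.
have [d1 [d2 [d10 d20 tail]]] := powR_sum_tail hp.
have tailX (d : measure_display) (T : measurableType d) (P : probability T R)
    (I : finType) (xi : I -> {RV P >-> R}) :
    mutually_independent P (fun i => xi i : T -> R) ->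
    (forall i, sub_gaussian P (xi i)) ->
    let Z : T -> R := power_sum p (fun i => xi i : T -> R) in
    let b : I -> R := centered_power_norm P p (fun i => xi i : T -> R) in
    forall x : R, 0 < x ->
    let t : R := d1 * lq_norm 2%:E b * Num.sqrt x
                 + d2 * lq_norm (dual_exponent p) b * x `^ (p / 2) in
    ((exists i, b i != 0) ->
       (P [set w | (t <= `|Z w - mean P Z|)%R] <= (2 * expR (- x))%:E)%E) /\
    (P [set w | (t < `|Z w - mean P Z|)%R] <= (2 * expR (- x))%:E)%E.
  move=> indxi subxi Z b x x0 t.
  have := tail d T P I xi _ b indxi (measurable_centered_power p xi)
    (integrable_centered_power hp subxi) (centered_power_norm_ge0 p xi)
    (centered_power_integral0 hp subxi) (centered_power_moment_le hp subxi) x x0.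
  rewrite /= -/t.
  have setE (Q : R -> Prop) : [set w | Q `|Z w - mean P Z|] =
      [set w | Q `|\sum_i (`|xi i w| `^ p - mean P (fun w => `|xi i w| `^ p))|].
    by apply/seteqP; split => w /=; rewrite (centered_power_sumE hp subxi).
  by rewrite (setE (fun y => t <= y)) (setE (fun y => t < y)).
split.
  by exists d1, d2; split=> // d T P I xi indxi _ subxi; exact: tailX.
(* A value strictly above the norm [K], at which the exponential moment is at most 2; the absolute
   value keeps it positive for every real [K]. *)
move=> K; set eta := `|K| + 1.
have eta0 : 0 < eta by rewrite ltr_wpDl.
set B := centered_bound p eta; have B0 : 0 <= B by exact: powR_ge0.
(* The [+ 1] in the first constant makes the new threshold strictly larger than the general one, so
   the event [t <= |Z - E Z|] lies in [s < |Z - E Z|] and the unconditional strict bound applies. *)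
exists (d1 * B + 1), (d2 * B + 1); split.
- by rewrite ltr_wpDl// mulr_ge0// ltW.
- by rewrite ltr_wpDl// mulr_ge0// ltW.
move=> d T P I xi I0 indxi _ _ normxi Z x x0.
pose t : R := (d1 * B + 1) * Num.sqrt (#|I|%:R * x)
  + (d2 * B + 1) * #|I|%:R `^ pos_part (1 - p / 2) * x `^ (p / 2).
rewrite -/t.
have subxi i : sub_gaussian P (xi i) by rewrite /sub_gaussian normxi ltry.
pose b := centered_power_norm P p (fun i => xi i : T -> R).
pose s := d1 * lq_norm 2%:E b * Num.sqrt x
          + d2 * lq_norm (dual_exponent p) b * x `^ (p / 2).
have tails : (P [set w | (s < `|Z w - mean P Z|)%R] <= (2 * expR (- x))%:E)%E.
  by have [] := tailX d T P I xi indxi subxi x x0.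
have bB i : `|b i| <= B.
  have [_ EX] : 0 < eta /\
      ('E_P[fun w => expR ((`|xi i w| / eta) `^ 2)] <= 2%:E)%E.
    apply: orlicz_norm_lt => //; rewrite normxi lte_fin /eta.
    by rewrite (le_lt_trans (ler_norm K))// ltrDl.
  have [_ le] := orlicz_norm_centered_power_le hp eta0 (measurable_funP (xi i)) EX.
  rewrite ger0_norm; last exact: centered_power_norm_ge0.
  rewrite -lee_fin /b /centered_power_norm fineK//.
  rewrite ge0_fin_numE ?orlicz_norm_ge0//; exact: le_lt_trans le (ltry _).
have st : s < t.
  have D0 : 0 < #|I|%:R :> R by rewrite ltr0n.
  have sq0 : 0 < Num.sqrt (#|I|%:R * x) by rewrite sqrtr_gt0 mulr_gt0.
  have b2 : lq_norm 2%:E b * Num.sqrt x <= B * Num.sqrt (#|I|%:R * x).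
    rewrite sqrtrM ?ler0n// mulrA ler_wpM2r ?sqrtr_ge0//.
    by rewrite -powR12_sqrt ?ler0n// lq_norm_le.
  have bq := lq_norm_dual_le p B0 bB.
  rewrite /s /t; apply: ltr_leD.
    rewrite -mulrA mulrDl mul1r -mulrA.
    apply: (@le_lt_trans _ _ (d1 * (B * Num.sqrt (#|I|%:R * x)))).
      by rewrite ler_pM2l.
    by rewrite ltrDl.
  rewrite ler_wpM2r ?powR_ge0// mulrDl mul1r -mulrA ler_wpDr ?powR_ge0//.
  by rewrite ler_pM2l.
apply: le_trans tails.
have mS : measurable_fun setT (fun w => Z w - mean P Z).
  apply: measurable_funB => //; apply: measurable_sum => i.
  apply: (measurableT_comp (measurable_powR p)); exact: measurableT_comp.
apply: le_measure; rewrite ?inE.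
- exact: measurable_ge_norm.
- exact: measurable_gt_norm.
- by move=> w /=; exact: lt_le_trans.
Qed.
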